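(* Let $X$ be a finite-dimensional Banach space over $\mathbb{F}$ ($\mathbb{F}=\mathbb{R}$ or $\mathbb{C}$) for which the numerical radius $w(\cdot)$ is a norm on $\mathcal{L}(X)$. Let $\mathcal{V}$ be an $n$-dimensional subspace of $\mathcal{L}(X)_w$ and $T\in\mathcal{L}(X)_w\setminus\mathcal{V}$. Then there exist scalars $t_1,t_2,\ldots,t_h>0$ ($h\leq n+1$ if $\mathbb{F}=\mathbb{R}$ and $h\leq 2n+1$ if $\mathbb{F}=\mathbb{C}$) such that $\sum_{i=1}^h t_i=1$ and $$d_w(T,\mathcal{V})=\max\Big\{\sum_{i=1}^h t_i x_i^*(Tx_i)\Big\},$$ where the maximum (which is attained) is over all $x_i^*\in E_{X^*}$, $x_i\in E_X$ ($1\le i\le h$) satisfying $|x_i^*(x_i)|=1$ for all $1\le i\le h$, $\sum_{i=1}^h t_i\Im(x_i^*(Tx_i))=0$, and $\sum_{i=1}^h t_i x_i^*(Sx_i)=0$ for all $S\in\mathcal{V}$.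
   Context: For a Banach space $X$ over $\mathbb{F}\in\{\mathbb{R},\mathbb{C}\}$, $X^*$ is its dual and $S_X$ its unit sphere. $E_X$ (resp. $E_{X^*}$) denotes the set of all extreme points of the closed unit ball of $X$ (resp. $X^*$). $\mathcal{L}(X)$ is the space of bounded linear operators on $X$. The numerical radius of $T\in\mathcal{L}(X)$ is $w(T)=\sup\{|x^*(Tx)| : x^*\in S_{X^*},\ x\in S_X,\ x^*(x)=1\}$; only spaces $X$ for which $w(\cdot)$ is a norm on $\mathcal{L}(X)$ are considered. $\mathcal{L}(X)_w$ denotes $\mathcal{L}(X)$ with the norm $w(\cdot)$. For a subspace $\mathcal{V}$ of $\mathcal{L}(X)_w$, $d_w(T,\mathcal{V})=\inf\{w(T-S) : S\in\mathcal{V}\}$. $\Im(\lambda)$ is the imaginary part of $\lambda\in\mathbb{F}$. *)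

(* Defs.v *)
From HB Require Import structures.
From mathcomp Require Import all_boot all_order all_algebra.
From mathcomp Require Import complex.
From mathcomp Require Import all_classical all_reals all_analysis.
Set Implicit Arguments.
Unset Strict Implicit.
Unset Printing Implicit Defensive.
Import Order.TTheory GRing.Theory Num.Theory numFieldNormedType.Exports.

Local Open Scope classical_set_scope.
Local Open Scope ring_scope.

Variant scalar_kind := RealScalars | ComplexScalars.

Definition scalars (R : realType) (k : scalar_kind) : numFieldType :=
  match k with
  | RealScalars => R
  | ComplexScalars => R[i]
  end.

Definition sre (R : realType) (k : scalar_kind) : scalars R k -> R :=
  match k return scalars R k -> R with
  | RealScalars => fun x => x
  | ComplexScalars => fun z => complex.Re z
  end.

Definition sim (R : realType) (k : scalar_kind) : scalars R k -> R :=
  match k return scalars R k -> R with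
  | RealScalars => fun=> 0
  | ComplexScalars => fun z => complex.Im z
  end.

Definition of_real (R : realType) (k : scalar_kind) : R -> scalars R k :=
  match k return R -> scalars R k with
  | RealScalars => fun x => x
  | ComplexScalars => fun x => real_complex R x
  end.
Arguments of_real {R} k x.

Section LinearAlgebra.
Variables (K : numFieldType) (E : lmodType K).

Definition lin_indep n (b : 'I_n -> E) :=
  forall c : 'I_n -> K, \sum_(i < n) c i *: b i = 0 -> forall i, c i = 0.

Definition lin_span n (b : 'I_n -> E) : set E :=
  [set v | exists c : 'I_n -> K, v = \sum_(i < n) c i *: b i].

Definition subspace_of_dim n (A : set E) :=
  exists b : 'I_n -> E, lin_indep b /\ A = lin_span b.

(* 0 < t < 1 in the order of a numFieldType forces t to be real. *)
Definition extreme_points (B : set E) : set E :=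
  [set x | B x /\ forall (y z : E) (t : K), B y -> B z -> 0 < t < 1 ->
                    x = (1 - t) *: y + t *: z -> y = x /\ z = x].

End LinearAlgebra.

Definition finite_dimensional (K : numFieldType) (E : lmodType K) :=
  exists n, subspace_of_dim n [set: E].

Section Operators.
Variables (R : realType) (k : scalar_kind).
Local Notation F := (scalars R k).
Variable X : completeNormedModType F.

(* Operators and functionals are functions satisfying a predicate; their
   vector space operations are the pointwise ones. *)
Definition operators : set (X -> X) :=
  [set T | linear T /\ exists M : F, forall x, `|T x| <= M * `|x|].

Definition dual : set (X -> F^o) :=
  [set f | linear f /\ exists M : F, forall x, `|f x| <= M * `|x|].

Definition unit_sphere : set X := [set x | `|x| = 1].

Definition unit_ball : set X := [set x | `|x| <= 1].

(* Norms take their values in F; [sre] recovers them as elements of R. *)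
Definition dual_norm (f : X -> F^o) : R :=
  sup [set sre `|f x| | x in unit_ball].

Definition dual_sphere : set (X -> F^o) :=
  [set f | dual f /\ dual_norm f = 1].

Definition dual_ball : set (X -> F^o) :=
  [set f | dual f /\ dual_norm f <= 1].

Definition numerical_radius (T : X -> X) : R :=
  sup [set r | exists (f : X -> F^o) (x : X),
         [/\ dual_sphere f, unit_sphere x, f x = 1 & r = sre `|f (T x)|]].

Definition numerical_radius_is_norm :=
  [/\ forall T, operators T -> 0 <= numerical_radius T,
      forall T, operators T -> numerical_radius T = 0 -> T = 0,
      forall (a : F) T, operators T ->
        numerical_radius (a *: T) = sre `|a| * numerical_radius T
    & forall T S, operators T -> operators S ->
        numerical_radius (T + S) <= numerical_radius T + numerical_radius S].

Definition dist_w (T : X -> X) (V : set (X -> X)) : R :=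
  inf [set numerical_radius (T - S) | S in V].

Definition admissible (T : X -> X) (V : set (X -> X)) h (t : 'I_h -> R)
    (f : 'I_h -> X -> F^o) (x : 'I_h -> X) :=
  [/\ forall i, extreme_points dual_ball (f i) /\
                extreme_points unit_ball (x i),
      forall i, `|f i (x i)| = 1,
      \sum_(i < h) t i * sim (f i (T (x i))) = 0
    & forall S, V S -> \sum_(i < h) of_real k (t i) * f i (S (x i)) = 0].

End Operators.

Definition is_maximum (d : Order.disp_t) (P : porderType d) (A : set P) (m : P) :=
  A m /\ ubound A m.

(* Main.v *)
Require Import Defs.
From HB Require Import structures.
From mathcomp Require Import all_boot all_order all_algebra.
From mathcomp Require Import complex.
From mathcomp Require Import all_classical all_reals all_analysis.
From mathcomp Require Import ring lra.
Set Implicit Arguments.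
Unset Strict Implicit.
Unset Printing Implicit Defensive.
Import Order.TTheory GRing.Theory Num.Theory numFieldNormedType.Exports.

Local Open Scope classical_set_scope.
Local Open Scope ring_scope.

(** Put d = d_w(T, V) and let s_1, ..., s_m span V over the reals, so m = n or
    2n.  To a pair (f, x) with |f x| = 1 in the product of the unit balls attach
    the vector (Re f(Tx), Re f(s_1 x), ..., Re f(s_m x)) of R^(m+1).  These
    vectors form a compact set, and its support function at (c_0, ..., c_m) is
    w(c_0 T + sum_j c_j s_j) >= c_0 d; hence (d, 0, ..., 0) lies in its convex
    hull.  Minkowski's theorem, applied first to the face of the dual ball cut
    out by x and then to the face of the ball cut out by f, lets one replace
    the pairs by extreme ones.  Finally a basic solution of the linear program
    that maximizes the first coordinate subject to the m vanishing constraints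
    uses at most m + 1 pairs; its value is at least d, and it is at most d
    because sum_i t_i f_i((T - S) x_i) is bounded by w(T - S) for all S in V. *)

(** * Convex hulls and Caratheodory's theorem *)

Section Convexity.
Variables (R : realType) (E : lmodType R).

Definition is_convex (D : set E) :=
  forall x y (s : R), D x -> D y -> 0 <= s <= 1 -> D (x + s *: (y - x)).

(* Zero weights are allowed, so [h] only bounds the number of points used. *)
Definition convex_comb (A : set E) h (p : E) :=
  exists (t : 'I_h -> R) (z : 'I_h -> E),
    [/\ forall i, 0 <= t i, \sum_i t i = 1, forall i, A (z i)
      & p = \sum_i t i *: z i].

(** As an intersection of all convex supersets, the hull is used by choosing [D], for instance the
    preimage of a convex set under an affine map. *)
Definition convex_hull (A : set E) : set E :=
  [set p | forall D, is_convex D -> A `<=` D -> D p].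

Lemma segmentE (x y : E) (s : R) : x + s *: (y - x) = (1 - s) *: x + s *: y.
Proof. by rewrite scalerBr scalerBl scale1r addrA addrAC. Qed.

Lemma convex_comb_split (A : set E) h p : convex_comb A h.+1 p ->
  A p \/
  exists (q z : E) (s : R),
    [/\ convex_comb A h q, A z, 0 <= s <= 1 & p = q + s *: (z - q)].
Proof.
move=> [t [z [t0 t1 Az ->]]].
move: t1; rewrite !big_ord_recl /= => t1.
set S := \sum_(i < h) t (lift ord0 i) in t1.
have S0 : 0 <= S by apply: sumr_ge0.
have [Sz|Snz] := eqVneq S 0.
  left; rewrite Sz addr0 in t1; rewrite t1 scale1r big1 ?addr0 // => i _.
  by rewrite (psumr_eq0P _ Sz) ?scale0r.
right; exists (\sum_(i < h) (t (lift ord0 i) / S) *: z (lift ord0 i)),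
  (z ord0), (t ord0); split=> //.
- exists (fun i => t (lift ord0 i) / S), (fun i => z (lift ord0 i)); split=> //.
    by move=> i; rewrite divr_ge0.
  by rewrite -mulr_suml divff.
- by rewrite t0 /= -t1 lerDl.
rewrite segmentE (_ : 1 - t ord0 = S); last by rewrite -t1 addrAC subrr add0r.
rewrite addrC scaler_sumr; congr (_ + _); apply: eq_bigr => i _.
by rewrite scalerA mulrCA divff // mulr1.
Qed.

Lemma hull_convex_comb (A : set E) p :
  convex_hull A p -> exists h, convex_comb A h p.
Proof.
(* Convex combinations of all lengths form a convex set: concatenate the two families, with weights
   scaled by [1 - s] and [s]. *)
move=> /(_ [set q | exists h, convex_comb A h q]); apply.
  move=> x y s [h [t [z [t0 t1 Az ->]]]] [l [u [w [u0 u1 Aw ->]]]]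
    /andP[s0 s1].
  pose tt (i : 'I_h + 'I_l) :=
    match i with inl i => (1 - s) * t i | inr i => s * u i end.
  pose zz (i : 'I_h + 'I_l) := match i with inl i => z i | inr i => w i end.
  exists (h + l)%N, (fun i => tt (fintype.split i)), (fun i => zz
    (fintype.split i)); split.
  - by move=> i; case: (fintype.split i) => j /=; rewrite mulr_ge0 // subr_ge0.
  - rewrite big_split_ord /=.
    under eq_bigr => i _ do rewrite (unsplitK (inl i)) /=.
    under [X in _ + X]eq_bigr => i _ do rewrite (unsplitK (inr i)) /=.
    by rewrite -!mulr_sumr t1 u1 !mulr1 subrK.
  - by move=> i; case: (fintype.split i) => j /=.
  rewrite segmentE big_split_ord /= !scaler_sumr; congr (_ + _);
    apply: eq_bigr => i _; rewrite scalerA.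
    by rewrite (unsplitK (inl i)).
  by rewrite (unsplitK (inr i)).
move=> z Az; exists 1%N, (fun=> 1), (fun=> z); split=> //.
  by rewrite big_ord1.
by rewrite big_ord1 scale1r.
Qed.

Lemma convex_comb_lift (A : set E) h (t : 'I_h.+1 -> R) (z : 'I_h.+1 -> E) i0 :
  (forall i, 0 <= t i) -> \sum_i t i = 1 -> (forall i, A (z i)) -> t i0 = 0 ->
  convex_comb A h (\sum_i t i *: z i).
Proof.
move=> t0 t1 Az ti0; exists (t \o lift i0), (z \o lift i0); split=> //=.
  by move: t1; rewrite (bigD1_ord i0) //= ti0 add0r.
by rewrite (bigD1_ord i0) //= ti0 scale0r add0r.
Qed.

(** Zero weights are discarded one at a time, since the weights finally produced must be strictly
    positive. *)
Lemma convex_comb_pos (A : set E) h p : convex_comb A h p ->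
  exists h' (t : 'I_h' -> R) (z : 'I_h' -> E),
    [/\ (h' <= h)%N, forall i, 0 < t i, \sum_i t i = 1, forall i, A (z i)
      & p = \sum_i t i *: z i].
Proof.
elim: h p => [|h IHh] p [t [z [t0 t1 Az ->]]].
  by move/eqP: t1; rewrite big_ord0 eq_sym oner_eq0.
have [[i ti]|tpos] := pselect (exists i, t i = 0).
  have [h' [t' [z' [h'h]]]] := IHh _ (convex_comb_lift t0 t1 Az ti).
  by exists h', t', z'; split=> //; exact: leqW.
exists h.+1, t, z; split=> // i; rewrite lt_neqAle t0 andbT eq_sym.
by apply/eqP => ti; apply: tpos; exists i.
Qed.

End Convexity.

Section Caratheodory.
Variables (R : realType) (N q : nat) (G : 'M[R]_(N, q)) (a : 'cV[R]_N).
Local Notation obj p := ((p *m a) 0 0).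

(* Move the weights along an affine dependence of the images under [G], in the
   direction that does not decrease the objective, until a weight vanishes. *)
Lemma caratheodory_step (A : set 'rV[R]_N) h p : (q < h)%N ->
  convex_comb A h.+1 p ->
  exists p', [/\ convex_comb A h p', p' *m G = p *m G & obj p <= obj p'].
Proof.
move=> qh [t [z [t0 t1 Az ->]]].
pose Z : 'M[R]_(h.+1, N) := \matrix_i z i.
have sumZ (w : 'rV_h.+1) : \sum_i w 0 i *: z i = w *m Z.
  by rewrite mulmx_sum_row; apply: eq_bigr => i _; rewrite rowK.
(* The matrix [M] has [h + 1] rows and [q + 1 <= h] columns, so its left kernel is nonzero; the sign
   of [v] is then chosen according to the objective. *)
have [v [vZ v0 vobj]] : exists v : 'rV[R]_h.+1,
    [/\ v *m row_mx (const_mx 1 : 'cV_h.+1) (Z *m G) = 0, v != 0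
      & 0 <= obj (v *m Z)].
  set M := row_mx _ _.
  have /rowV0Pn[v /sub_kermxP vM v0] : kermx M != 0.
    rewrite -mxrank_eq0 mxrank_ker subn_eq0 -ltnNge.
    by rewrite (leq_ltn_trans (rank_leq_col _)).
  have [vo|vo] := leP 0 (obj (v *m Z)); first by exists v.
  exists (- v); rewrite mulNmx vM oppr0 oppr_eq0; split=> //.
  by rewrite !mulNmx mxE oppr_ge0 ltW.
move: vZ; rewrite mul_mx_row => /eqP; rewrite row_mx_eq0 => /andP[/eqP v1 /eqP
  vG].
have {}v1 : \sum_i v 0 i = 0.
  have /matrixP/(_ 0 0) := v1; rewrite !mxE => v1'.
  by rewrite -[RHS]v1'; apply: eq_bigr => j _; rewrite mxE mulr1.
have [i vi] : exists i, v 0 i < 0.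
  apply/existsP; apply: contra_neqT v0; rewrite negb_exists => /forallP vge.
  have {}vge i : 0 <= v 0 i by rewrite leNgt.
  by apply/rowP => i; rewrite mxE (psumr_eq0P _ v1).
(* Ratio test: [s] is the largest step keeping every [t i + s * v 0 i] nonnegative, and the weight
   at [i0] becomes zero. *)
case: (@arg_minP _ _ _ i (fun j => v 0 j < 0) (fun j => t j / - v 0 j) vi) =>
  i0 vi0 mini {i vi}.
set s := t i0 / - v 0 i0 in mini.
have s0 : 0 <= s by rewrite divr_ge0 // oppr_ge0 ltW.
pose w : 'rV_h.+1 := \row_i t i + s *: v.
exists (\sum_i w 0 i *: z i); split.
- apply: (@convex_comb_lift _ _ _ _ _ _ i0) => // [i||].
  + rewrite !mxE; have [vi|vi] := leP 0 (v 0 i).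
      by rewrite addr_ge0 // mulr_ge0.
    by have := mini _ vi; rewrite ler_pdivlMr ?oppr_gt0 // mulrN lerNl -subr_ge0
      opprK addrC.
  + under eq_bigr => i _ do rewrite !mxE.
    by rewrite big_split /= -mulr_sumr v1 mulr0 addr0.
  by rewrite !mxE /s invrN mulrN mulNr divfK ?subrr // lt_eqF.
- rewrite sumZ mulmxDl -scalemxAl mulmxDl -scalemxAl -(mulmxA v) vG scaler0
  addr0.
  by rewrite -sumZ; congr (_ *m _); apply: eq_bigr => i _; rewrite mxE.
rewrite sumZ mulmxDl -scalemxAl mulmxDl -scalemxAl [leRHS]mxE -sumZ.
under [X in _ <= (X *m _) _ _ + _]eq_bigr => i _ do rewrite mxE.
by rewrite lerDl mxE mulr_ge0.
Qed.

(** A linear program with objective [a], [q] equality constraints given by [G], and the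
    normalization of the weights: a feasible point is improved to a basic one, hence the bound
    [q.+1]. *)
Lemma caratheodory (A : set 'rV[R]_N) h p : convex_comb A h p ->
  exists h' p', [/\ (h' <= q.+1)%N, convex_comb A h' p', p' *m G = p *m G
                  & obj p <= obj p'].
Proof.
elim: h p => [|h IHh] p Ap; first by exists 0%N, p.
have [hq|qh] := leqP h q; first by exists h.+1, p.
have [p1 [Ap1 p1G pp1]] := caratheodory_step qh Ap.
have [h' [p' [h'q Ap' p'G p1p']]] := IHh _ Ap1.
exists h', p'; split=> //; first by rewrite p'G.
exact: le_trans p1p'.
Qed.

End Caratheodory.

(** * Compactness of the convex hull and separation *)

Section CompactHull.
Variables (R : realType) (N : nat).
Local Notation dot u v := ((u *m v^T) 0 0).

Lemma dot_ge0 (u : 'rV[R]_N) : 0 <= dot u u.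
Proof.
by rewrite mxE sumr_ge0 // => i _; rewrite mxE -expr2 sqr_ge0.
Qed.

Lemma dot_eq0 (u : 'rV[R]_N) : dot u u = 0 -> u = 0.
Proof.
rewrite mxE => /psumr_eq0P u0; apply/rowP => i; rewrite [RHS]mxE.
apply/eqP; rewrite -sqrf_eq0 expr2; have := u0 _ i isT; rewrite mxE => -> //.
by move=> j _; rewrite mxE -expr2 sqr_ge0.
Qed.

Lemma dotC (u v : 'rV[R]_N) : dot u v = dot v u.
Proof. by rewrite -[u *m _]trmxK trmx_mul trmxK mxE. Qed.

Lemma dotBl (u v w : 'rV[R]_N) : dot (u - v) w = dot u w - dot v w.
Proof. by rewrite mulmxBl mxE [X in _ + X]mxE. Qed.

Lemma dotZl s (u w : 'rV[R]_N) : dot (s *: u) w = s * dot u w.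
Proof. by rewrite -scalemxAl mxE. Qed.

Lemma continuous_sum (V : normedModType R) (T : topologicalType) (I : finType)
    (F : I -> T -> V) :
  (forall i, continuous (F i)) -> continuous (fun x => \sum_i F i x).
Proof.
move=> cF x; elim: (index_enum I) => [|i s IHs].
  rewrite (_ : (fun _ => _) = cst 0); first exact: cst_continuous.
  by apply/funext => y; rewrite big_nil.
rewrite (_ : (fun _ => _) = (fun y => F i y + \sum_(j <- s) F j y)).
  by apply: continuousD; [exact: cF | exact: IHs].
by apply/funext => y; rewrite big_cons.
Qed.

(** Induction on [h]: the next set is [Z] together with the image of [C], [Z] and [[0, 1]] under the
    segment map. Sandwiching [C] between the short combinations and the hull avoids describing it
    exactly. *)
Lemma compact_convex_comb (Z : set 'rV[R]_N) h : compact Z ->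
  exists C, [/\ compact C, C `<=` convex_hull Z
    & forall h' p, (h' <= h)%N -> convex_comb Z h' p -> C p].
Proof.
move=> cZ; elim: h => [|h [C [cC CZ Ch]]].
  exists set0; split=> [|//|h' p]; first exact: compact0.
  rewrite leqn0 => /eqP -> [t [z [_ /eqP]]].
  by rewrite big_ord0 eq_sym oner_eq0.
pose f (w : 'rV[R]_N * 'rV[R]_N * R^o) : 'rV[R]_N :=
  w.1.1 + w.2 *: (w.1.2 - w.1.1).
exists (Z `|` f @` (C `*` Z `*` `[0, 1])); split.
- apply: compactU => //; apply: continuous_compact; last first.
    by apply: compact_setX; [exact: compact_setX | exact: segment_compact].
  apply: continuous_subspaceT => w.
  have c11 : w.1.1 @[w --> w] --> w.1.1.
    by apply: (@cvg_comp _ _ _ fst fst); exact: cvg_fst.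
  apply: cvgD; first exact: c11.
  apply: cvgZ; first exact: cvg_snd.
  apply: cvgB; last exact: c11.
  by apply: (@continuous_comp _ _ _ fst snd w);
    [exact: cvg_fst | exact: cvg_snd].
- move=> p [Zz D _ ZD|[[[q z] s] [[/= Cq Zz] s01] <- D cD ZD]].
    exact: ZD.
  by apply: (cD); [exact: CZ Cq D cD ZD | exact: ZD | rewrite /= in_itv in s01].
move=> [|h'] p h'h.
  by move=> [t [z [_ /eqP]]]; rewrite big_ord0 eq_sym oner_eq0.
move=> /convex_comb_split[Zp|[q [z [s [qZ Zz s01 ->]]]]]; first by left.
right; exists (q, z, s) => //; split=> /=; last by rewrite in_itv.
by split=> //; apply: Ch qZ.
Qed.

(** With [G] the identity and a zero objective, [caratheodory] preserves the point itself and bounds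
    the length of every combination by [N.+1]. *)
Lemma compact_hull (Z : set 'rV[R]_N) : compact Z -> compact (convex_hull Z).
Proof.
move=> /(compact_convex_comb N.+1)[C [cC CZ Ch]].
suff -> : convex_hull Z = C by [].
apply/seteqP; split=> // p /hull_convex_comb[h].
move=> /(caratheodory 1%:M 0)[h' [p' [h'N Zp' ]]].
by rewrite !mulmx1 => <- _; exact: Ch Zp'.
Qed.

(* The gradient of the distance to [p] at the point of the hull nearest to [p]
   is a separating functional. *)
Lemma support_hull (Z : set 'rV[R]_N) p : compact Z -> Z !=set0 ->
  (forall (c : 'cV_N) b, (forall z, Z z -> (z *m c) 0 0 <= b) ->
    (p *m c) 0 0 <= b) ->
  convex_hull Z p.
Proof.
move=> cZ [z0 Zz0] supp.
have ZS : Z `<=` convex_hull Z by move=> z Zz D _; apply.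
have cS : is_convex (convex_hull Z).
  by move=> x y s Sx Sy s01 D cD ZD; apply: (cD) => //; [apply: Sx|apply: Sy].
have [||q Sq minq] := EVT_min_rV _ (compact_hull cZ)
    (f := fun q => dot (p - q) (p - q)).
- by exists z0; exact: ZS.
- apply: continuous_subspaceT => q.
  rewrite (_ : (fun _ => _) = (fun q => \sum_j (p - q) 0 j * (p - q) 0 j)).
    have cj j : continuous (fun q : 'rV[R]_N => (p - q) 0 j).
      rewrite (_ : (fun _ => _) = (fun q : 'rV[R]_N => p 0 j - q 0 j)).
        move=> x; apply: continuousB; first exact: cst_continuous.
        exact: coord_continuous.
      by apply/funext => x; rewrite !mxE.
    by apply: continuous_sum => j x; apply: continuousM; exact: cj.
  by apply/funext => x; rewrite mxE; apply: eq_bigr => j _;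
    rewrite [X in _ * X]mxE.
rewrite inE in Sq; set e := p - q.
(* Once [e] is maximized over [Z] by its value at [q], the hypothesis gives [dot p e <= dot q e],
   that is [dot e e <= 0], so [p = q]. *)
suff qe z : Z z -> dot z e <= dot q e.
  have := supp e^T _ qe; rewrite -subr_le0 => pe.
  suff /dot_eq0/eqP : dot e e = 0 by rewrite subr_eq0 => /eqP ->.
  apply/eqP; rewrite eq_le dot_ge0 andbT.
  by rewrite {1}/e dotBl.
move=> Zz; rewrite -subr_le0 -dotBl.
set dz := z - q; set a := dot dz e.
rewrite leNgt; apply/negP => a0.
have D0 := dot_ge0 dz.
(* This step satisfies [s <= 1]. Moving from [q] towards [z] by it changes the squared distance by
   [- 2 * s * a + s ^+ 2 * dot dz dz = - s * a * (1 + s) < 0], against the minimality of [q]. *)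
pose s := a / (a + dot dz dz).
have aD : 0 < a + dot dz dz by rewrite ltr_wpDr.
have s0 : 0 < s by rewrite divr_gt0.
have : dot e e <= dot (e - s *: dz) (e - s *: dz).
  have := minq (q + s *: dz); rewrite inE opprD addrA; apply; apply: cS => //.
    exact: ZS.
  by rewrite ltW //= ler_pdivrMr // mul1r lerDl.
clearbody e dz.
rewrite !(dotBl, dotZl) !(dotC _ (e - _)) !(dotBl, dotZl) (dotC e dz) -/a.
have : s * (a + dot dz dz) = a by rewrite divfK // gt_eqF.
nra.
Qed.
End CompactHull.

(** * Minkowski's theorem *)

Section Minkowski.
Variables (R : realType) (N : nat) (C : set 'rV[R]_N).
Hypotheses (Ccompact : compact C) (Cconvex : is_convex C).

(** For [p] in [C] these directions form a linear space, that of the smallest face of [C] containing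
    [p]; it is zero exactly when [p] is extreme. *)
Definition two_sided p (v : 'rV[R]_N) :=
  exists2 e : R, 0 < e & C (p + e *: v) /\ C (p - e *: v).

Lemma two_sided_lt p v e d : C (p + e *: v) -> C p -> 0 <= d <= e -> 0 < e ->
  C (p + d *: v).
Proof.
move=> Cpe Cp /andP[d0 de] e0.
have := Cconvex Cp Cpe (s := d / e); rewrite addrAC subrr add0r scalerA.
rewrite divfK ?gt_eqF //; apply.
by rewrite divr_ge0 //= ?(ltW e0) // ler_pdivrMr // mul1r.
Qed.

Lemma two_sidedZ p v c : C p -> two_sided p v -> two_sided p (c *: v).
Proof.
move=> Cp [e e0 [C1 C2]].
wlog c0 : c v C1 C2 / 0 <= c.
  move=> W; have [/W|c0] := leP 0 c; first exact.
  have := W (- c) (- v); rewrite !scalerN scaleNr !opprK; apply=> //.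
  by rewrite oppr_ge0 ltW.
have [->|cn0] := eqVneq c 0.
  by exists 1; rewrite // scale0r scaler0 subr0 addr0.
exists (e / c); first by rewrite divr_gt0 // lt_def cn0.
by rewrite scalerA divfK.
Qed.

Lemma two_sidedD p v w : C p -> two_sided p v -> two_sided p w ->
  two_sided p (v + w).
Proof.
move=> Cp [e e0 [C1 C2]] [d d0 [C3 C4]].
pose m := Num.min e d.
have m0 : 0 < m by rewrite lt_min e0.
have me : 0 <= m <= e by rewrite ltW //= ge_min lexx.
have md : 0 <= m <= d by rewrite ltW //= ge_min lexx orbT.
rewrite -!scalerN in C2 C4.
have half (x y : 'rV[R]_N) : C (p + m *: x) -> C (p + m *: y) ->
    C (p + (m / 2) *: (x + y)).
  move=> Cx Cy.
  have -> : p + (m / 2) *: (x + y) =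
      p + m *: x + 2^-1 *: (p + m *: y - (p + m *: x)).
    by apply/rowP => i; rewrite !mxE; field.
  by apply: Cconvex => //; apply/andP; split; lra.
exists (m / 2); first by rewrite divr_gt0.
split; first by apply: half; [exact: two_sided_lt C1 _ me e0
                             |exact: two_sided_lt C3 _ md d0].
rewrite -scalerN opprD; apply: half; [exact: two_sided_lt C2 _ me e0
                                     |exact: two_sided_lt C4 _ md d0].
Qed.

Lemma two_sided_mul p k (c : 'rV[R]_k) (A : 'M[R]_(k, N)) : C p ->
  (forall i, two_sided p (row i A)) -> two_sided p (c *m A).
Proof.
move=> Cp pA; rewrite mulmx_sum_row.
elim/big_ind : _ => [|x y|i _]; last exact: two_sidedZ.
  by exists 1 => //; rewrite scaler0 subr0 addr0.
exact: two_sidedD.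
Qed.

(** As [C] is compact and [v] is nonzero, the admissible steps form a compact set, which has a
    largest element. *)
Lemma exit_point p v : C p -> v != 0 ->
  exists s, [/\ 0 <= s, C (p + s *: v) & forall e, s < e -> ~ C (p + e *: v)].
Proof.
move=> Cp v0.
pose L := [set s : R | 0 <= s /\ C (p + s *: v)].
have [M M0 CM] : exists2 M, 0 <= M & forall q, C q -> `|q| <= M.
  have [M [_ CM]] := compact_bounded Ccompact.
  have {}CM q : C q -> `|q| <= M + 1 by move=> Cq; apply: CM Cq; rewrite ltrDl.
  by exists (M + 1) => //; apply: le_trans (CM _ Cp).
have Lc : compact L.
  apply: (@subclosed_compact _ _ `[0, (M + `|p|) / `|v|]).
  - rewrite (_ : L = [set s | 0 <= s] `&` (fun s : R => p + s *: v) @^-1` C) //.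
    apply: closedI; first exact: closed_ge.
    apply: preimage_closed; last by apply: compact_closed;
      first exact: norm_hausdorff.
    move=> s _; apply: cvgD; first exact: cvg_cst.
    by apply: cvgZr_tmp; exact: cvg_id.
  - exact: segment_compact.
  move=> s [s0 /CM sM] /=; rewrite in_itv /= s0 ler_pdivlMr ?normr_gt0 //.
  have -> : s * `|v| = `|(p + s *: v) - p|.
    by rewrite addrAC subrr add0r normrZ ger0_norm.
  by rewrite (le_trans (ler_normB _ _)) // lerD2r.
have [||s] := compact_EVT_max (f := idfun) _ Lc.
- by exists 0; split=> //; rewrite scale0r addr0.
- by apply: continuous_subspaceT => x; exact: cvg_id.
rewrite inE => -[s0 Cs] smax; exists s; split=> // e se Ce.
have /smax : e \in L by rewrite inE; split=> //; exact: ltW (le_lt_trans s0 se).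
by rewrite /= leNgt se.
Qed.

(** The homothety with center [p - e *: v] and ratio [e / (s + e)] sends [p + s *: v] to [p] and, by
    convexity, maps [C] into itself. *)
Lemma two_sided_exit p v s e w : 0 <= s -> 0 < e -> C p ->
  C (p - e *: v) -> C (p + s *: v) ->
  two_sided (p + s *: v) w -> two_sided p w.
Proof.
move=> s0 e0 Cp Ce Cs [d d0 [C1 C2]].
have es : 0 < s + e by rewrite ltr_wpDl.
have l01 : 0 <= s / (s + e) <= 1.
  by rewrite divr_ge0 ?(ltW es) //= ler_pdivrMr // mul1r lerDl ltW.
exists (e / (s + e) * d); first by rewrite mulr_gt0 // divr_gt0.
split.
  have := Cconvex C1 Ce l01; congr (C _).
  by apply/rowP => i; rewrite !mxE; field; rewrite gt_eqF.
have := Cconvex C2 Ce l01; congr (C _).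
by apply/rowP => i; rewrite !mxE; field; rewrite gt_eqF.
Qed.

Lemma extreme_no_two_sided p : C p -> (forall v, two_sided p v -> v = 0) ->
  extreme_points C p.
Proof.
move=> Cp p0; split=> // y z t Cy Cz /andP[t0 t1] pE.
suff zy : z - y = 0.
  have {}zy : z = y by apply/eqP; rewrite -subr_eq0 zy.
  by rewrite pE zy -scalerDl subrK scale1r.
pose m := Num.min t (1 - t).
have mt : m <= t by rewrite ge_min lexx.
have m1 : m <= 1 - t by rewrite ge_min lexx orbT.
have m0 : 0 < m by rewrite lt_min t0 subr_gt0.
apply: p0; exists m => //; split.
  have -> : p + m *: (z - y) = y + (t + m) *: (z - y).
    by rewrite pE; apply/rowP => i; rewrite !mxE; ring.
  by apply: Cconvex => //; apply/andP; split; lra.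
have -> : p - m *: (z - y) = y + (t - m) *: (z - y).
  by rewrite pE; apply/rowP => i; rewrite !mxE; ring.
by apply: Cconvex => //; apply/andP; split; lra.
Qed.

(* Induction on the dimension of the face generated by [p]: leaving [C] through
   [p] in both directions of a line gives two points in smaller faces. *)
Lemma minkowski_rank r p : C p ->
  (forall k (A : 'M[R]_(k, N)), (forall i, two_sided p (row i A)) ->
    (\rank A <= r)%N) ->
  convex_hull (extreme_points C) p.
Proof.
elim: r p => [|r IHr] p Cp pr D cD CD;
    (have [[v [pv v0]]|no] := pselect (exists v, two_sided p v /\ v != 0);
      last by apply/CD/extreme_no_two_sided => // v pv; apply/eqP;
        apply: contra_notT no => v0; exists v).
  have := pr 1%N v; rewrite leqn0 mxrank_eq0 (negPf v0) => /(_ _)/notF[] //.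
  by move=> i; rewrite row_id.
(* Two-sided directions at the exit point are also two-sided at [p], but [w] is lost, so the
   induction hypothesis applies there. *)
have exit w : two_sided p w -> w != 0 -> exists s,
    [/\ 0 <= s, C (p + s *: w) & D (p + s *: w)].
  move=> pw w0; have [s [s0 Cs smax]] := exit_point Cp w0.
  exists s; split=> //; apply: IHr => // k A sA.
  case: (pw) => d d0 [_ Cd].
  have pA i : two_sided p (row i A) by apply: two_sided_exit (sA i);
    [|exact: d0|..].
  have rAw : (\rank (col_mx A w) <= r.+1)%N.
    apply: pr => i; case: (split_ordP i) => j ->.
      by rewrite rowKu.
    by rewrite rowKd row_id.
  (* If the rank of [A] exceeded [r], then [w] would lie in its row space and be two-sided at the
     exit point, against the maximality of [s]. *)
  rewrite leqNgt; apply/negP => rA.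
  have /submxP[c wE] : (w <= A)%MS.
    have sA' : (A <= col_mx A w)%MS by rewrite -addsmxE addsmxSl.
    apply: (@submx_trans _ _ _ _ _ _ (col_mx A w)).
      by rewrite -addsmxE addsmxSr.
    by rewrite -(mxrank_leqif_sup sA') eqn_leq mxrankS //= (leq_trans rAw).
  have [e e0 [Ce _]] : two_sided (p + s *: w) w.
    by rewrite {2}wE; exact: two_sided_mul.
  apply: (smax (s + e)); first by rewrite ltrDl.
  by rewrite scalerDl addrA.
have vN0 : - v != 0 by rewrite oppr_eq0.
have pvN : two_sided p (- v) by rewrite -scaleN1r; exact: two_sidedZ.
have [s [s0 Cs Ds]] := exit v pv v0.
have [d [d0 Cd Dd]] := exit _ pvN vN0.
(* The point [p] divides the segment between the two exit points in the ratio [s : d]; if both steps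
   vanish, it is an exit point itself. *)
have [sd|sd] := eqVneq (s + d) 0.
  have -> : p = p + s *: v.
    have -> : s = 0 by lra.
    by rewrite scale0r addr0.
  exact: Ds.
have -> : p = p + s *: v + (s / (s + d)) *: (p + d *: - v - (p + s *: v)).
  by apply/rowP => i; rewrite !mxE; field.
apply: cD => //; rewrite divr_ge0 ?addr_ge0 //= ler_pdivrMr ?mul1r ?lerDl //.
by rewrite lt_def sd addr_ge0.
Qed.

Lemma minkowski : C `<=` convex_hull (extreme_points C).
Proof.
move=> p Cp; apply: (@minkowski_rank N) => // k A _; exact: rank_leq_col.
Qed.

End Minkowski.

(** * Faces cut out by a supporting hyperplane *)

Section Face.
Variables (R : realType) (N : nat).
Local Notation dot u v := ((u *m v^T) 0 0).

Lemma dot_continuous (c : 'rV[R]_N) : continuous (fun u : 'rV[R]_N => dot u c).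
Proof.
rewrite (_ : (fun _ => _) = (fun u : 'rV[R]_N => \sum_j u 0 j * c 0 j)).
  apply: continuous_sum => j u; apply: continuousM;
    first exact: coord_continuous.
  exact: cst_continuous.
apply/funext => u; rewrite mxE; apply: eq_bigr => j _.
by rewrite [X in _ * X]mxE.
Qed.

(** Minkowski's theorem holds in the face [G]. An extreme point of [G] is extreme in [C], because
    [dot y c <= 1] on [C] forces the ends of any segment through it to lie in [G] too. *)
Lemma face_minkowski (C : set 'rV[R]_N) (c x : 'rV[R]_N) :
  compact C -> is_convex C -> (forall y, C y -> dot y c <= 1) ->
  C x -> dot x c = 1 ->
  convex_hull [set y | extreme_points C y /\ dot y c = 1] x.
Proof.
move=> cC vC C1 Cx xc.
pose G := C `&` [set y | dot y c = 1].
have dotE (y z : 'rV[R]_N) (s : R) :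
    dot (y + s *: (z - y)) c = dot y c + s * (dot z c - dot y c).
  by rewrite mulmxDl mxE dotZl dotBl.
have cG : compact G.
  apply: (subclosed_compact _ cC) => [|y []//].
  apply: closedI; first by apply: compact_closed cC; exact: norm_hausdorff.
  rewrite (_ : [set y | _] = (fun y => dot y c) @^-1` [set 1]) //.
  apply: preimage_closed; last exact: closed_eq.
  by move=> y _; exact: dot_continuous.
have vG : is_convex G.
  move=> y z s [Cy yc] [Cz zc] s01; split; first exact: vC.
  by rewrite /= dotE yc zc subrr mulr0 addr0.
move=> D vD AD; apply: (minkowski cG vG _ vD) => // y [[Cy yc] yG]; apply: AD.
split=> //; split=> // z w t Cz Cw /[dup] t01 /andP[t0 t1] yE.
move: yc; rewrite /= {1}yE mulmxDl mxE !dotZl => yc.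
have zc1 := C1 _ Cz; have wc1 := C1 _ Cw.
by apply: yG yE => //; split=> //=; nra.
Qed.

End Face.

(** * Real and complex scalars *)

Section Scalars.
Variables (R : realType) (k : scalar_kind).
Local Notation F := (scalars R k).

(* Over the reals the imaginary unit is [0]: with this convention the identities
   [scalarE] and [simE] hold for both scalar fields. *)
Definition iunit : F :=
  match k return scalars R k with
  | RealScalars => 0
  | ComplexScalars => 'i%C
  end.

Lemma of_real_is_zmod_morphism : zmod_morphism (@of_real R k).
Proof. by case: k => // x y; rewrite [LHS]rmorphB. Qed.

HB.instance Definition _ :=
  GRing.isZmodMorphism.Build R F (@of_real R k) of_real_is_zmod_morphism.

Lemma of_real_is_monoid_morphism : monoid_morphism (@of_real R k).
Proof. by case: k; split => // x y; rewrite [LHS]rmorphM. Qed.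

HB.instance Definition _ :=
  GRing.isMonoidMorphism.Build R F (@of_real R k) of_real_is_monoid_morphism.

Lemma sre_is_zmod_morphism : zmod_morphism (@sre R k).
Proof. by case: k => // -[a b] [c d]. Qed.

HB.instance Definition _ :=
  GRing.isZmodMorphism.Build F R (@sre R k) sre_is_zmod_morphism.

Lemma sim_is_zmod_morphism : zmod_morphism (@sim R k).
Proof. by case: k => [x y|[a b] [c d]] //=; rewrite subr0. Qed.

HB.instance Definition _ :=
  GRing.isZmodMorphism.Build F R (@sim R k) sim_is_zmod_morphism.

Lemma sreB (z w : F) : sre (z - w) = sre z - sre w.
Proof. exact: raddfB. Qed.

Lemma sreD (z w : F) : sre (z + w) = sre z + sre w.
Proof. exact: raddfD. Qed.

Lemma sre_sum (I : finType) (z : I -> F) : sre (\sum_i z i) = \sum_i sre (z i).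
Proof. exact: raddf_sum. Qed.

Lemma sre_of_real (a : R) : sre (of_real k a) = a.
Proof. by case: k. Qed.

Lemma sim_of_real (a : R) : sim (of_real k a) = 0.
Proof. by case: k. Qed.

Lemma sreMl (a : R) (z : F) : sre (of_real k a * z) = a * sre z.
Proof. by case: k z => // -[x y] /=; rewrite mul0r subr0. Qed.

Lemma simMl (a : R) (z : F) : sim (of_real k a * z) = a * sim z.
Proof. by case: k z => [x|[x y]] /=; rewrite ?mulr0 // mul0r addr0. Qed.

Lemma simE (z : F) : sim z = - sre (iunit * z).
Proof.
rewrite /iunit; case: k z => [x|[x y]]; first by rewrite /= mul0r oppr0.
by rewrite /= mul0r sub0r mul1r opprK.
Qed.

Lemma sre_iunit (z : F) : sre (iunit * z) = - sim z.
Proof. by rewrite simE opprK. Qed.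

Lemma scalar_eq (z w : F) : sre z = sre w -> sim z = sim w -> z = w.
Proof. by case: k z w => [x y|[x y] [x' y']] //= -> ->. Qed.

Lemma scalarE (z : F) : z = of_real k (sre z) + iunit * of_real k (sim z).
Proof.
rewrite /iunit; case: k z => [x|z]; first by rewrite /= mul0r addr0.
exact: complexE.
Qed.

Lemma ler_of_real (a b : R) : (of_real k a <= of_real k b) = (a <= b).
Proof. by case: k => //; rewrite /= lecR. Qed.

Lemma ltr_of_real (a b : R) : (of_real k a < of_real k b) = (a < b).
Proof. by case: k => //; rewrite /= ltcR. Qed.

Lemma sreK (z : F) : 0 <= z -> of_real k (sre z) = z.
Proof.
by move=> z0; apply: scalar_eq; rewrite ?sre_of_real // sim_of_real;
  case: k z z0 => // z /ger0_Im.
Qed.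

Lemma norm_scalar (z : F) : `|z| = of_real k (Num.sqrt (sre z ^+ 2 + sim z ^+
  2)).
Proof.
case: k z => [x|z]; last exact: normc_def.
by rewrite /= expr0n addr0 sqrtr_sqr.
Qed.

Lemma sre_norm (z : F) : sre `|z| = Num.sqrt (sre z ^+ 2 + sim z ^+ 2).
Proof. by rewrite norm_scalar sre_of_real. Qed.

Lemma sre_norm_of_real (a : R) : sre `|of_real k a| = `|a|.
Proof.
by rewrite sre_norm sre_of_real sim_of_real expr0n addr0 sqrtr_sqr.
Qed.

Lemma norm_eq1 (z : F) : `|z| = 1 <-> sre z ^+ 2 + sim z ^+ 2 = 1.
Proof.
have p0 : 0 <= sre z ^+ 2 + sim z ^+ 2 by rewrite addr_ge0 // sqr_ge0.
split=> [/(congr1 (@sre R k))|z1]; last by rewrite norm_scalar z1 sqrtr1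
  rmorph1.
rewrite sre_norm -(rmorph1 (@of_real R k)) sre_of_real => s1.
by rewrite -[LHS]sqr_sqrtr // s1 expr1n.
Qed.

Lemma ler_sre_norm (z : F) : sre z <= sre `|z|.
Proof.
rewrite sre_norm (le_trans (ler_norm _)) // -sqrtr_sqr.
by rewrite ler_wsqrtr // lerDl sqr_ge0.
Qed.

(** The equality case of [ler_sre_norm]; it yields the condition on imaginary parts for the optimal
    family. *)
Lemma sim_eq0 (z : F) : sre `|z| <= sre z -> sim z = 0.
Proof.
rewrite sre_norm => zz; have z0 := le_trans (sqrtr_ge0 _) zz.
have : sre z ^+ 2 + sim z ^+ 2 <= sre z ^+ 2.
  rewrite -[leLHS]sqr_sqrtr ?addr_ge0 ?sqr_ge0 //.
  by rewrite ler_pXn2r // nnegrE sqrtr_ge0.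
by rewrite gerDl => s0; apply/eqP; rewrite -sqrf_eq0 eq_le s0 sqr_ge0.
Qed.

Lemma rotation (z : F) : exists2 l : F, `|l| = 1 & l * z = `|z|.
Proof.
have [->|z0] := eqVneq z 0; first by exists 1; rewrite ?normr1 // mulr0 normr0.
exists (`|z| / z); last by rewrite divfK.
by rewrite normrM normfV normr_id divff // normr_eq0.
Qed.

Section Norm.
Variable X : normedModType F.
Implicit Types x y : X.

Lemma normK x : of_real k (sre `|x|) = `|x|.
Proof. exact: sreK. Qed.

Lemma sre_norm_ge0 x : 0 <= sre `|x|.
Proof. by rewrite -ler_of_real normK rmorph0. Qed.

Lemma sre_normD x y : sre `|x + y| <= sre `|x| + sre `|y|.
Proof. by rewrite -ler_of_real rmorphD /= !normK ler_normD. Qed.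

Lemma sre_normZ (a : F) x : sre `|a *: x| = sre `|a| * sre `|x|.
Proof. by rewrite normrZ -[`|a|]sreK // sreMl !sreK. Qed.

Lemma sre_norm_eq0 x : sre `|x| = 0 -> x = 0.
Proof. by move=> x0; apply/normr0_eq0; rewrite -normK x0 rmorph0. Qed.

Lemma norm_le1 x : (`|x| <= 1) = (sre `|x| <= 1).
Proof. by rewrite -[`|x|]normK -[1 in LHS](rmorph1 (@of_real R k)) ler_of_real
  sre_of_real. Qed.

End Norm.
End Scalars.

Section RealBasis.
Variables (R : realType) (k : scalar_kind).
Local Notation F := (scalars R k).

Definition real_dim n :=
  match k with RealScalars => n | ComplexScalars => (2 * n)%N end.

(** Over the complex numbers [s] lists the vectors [b j] and then their multiples by the imaginary
    unit. This serves twice: for a basis of the space, to get real coordinates, and for the subspace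
    of operators, to count real constraints. *)
Lemma real_family (E : lmodType F) n (b : 'I_n -> E) :
  exists m (s : 'I_m -> E),
  [/\ m = real_dim n,
      forall v, lin_span b v <->
        exists c : 'I_m -> R, v = \sum_i of_real k (c i) *: s i,
      lin_indep b -> forall c : 'I_m -> R,
        \sum_i of_real k (c i) *: s i = 0 -> forall i, c i = 0
    & forall u : 'I_m -> R, exists y : 'I_n -> F, forall f : E -> F^o,
        linear f -> (forall j, f (b j) = y j) ->
        forall i, sre (f (s i)) = u i].
Proof.
rewrite /real_dim; case: k E b => E b.
  exists n, b; split=> // u.
  by exists u => f _ fb i; rewrite fb.
pose ii := iunit R ComplexScalars.
have ii2 : ii * ii = -1 by rewrite -expr2 /ii /= sqr_i.
have si z : sre (ii * z) = - sim z by exact: sre_iunit.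
pose s (i : 'I_(n + n)) :=
  match fintype.split i with inl j => b j | inr j => ii *: b j end.
have sl j : s (lshift n j) = b j by rewrite /s (unsplitK (inl j)).
have sr j : s (rshift n j) = ii *: b j by rewrite /s (unsplitK (inr j)).
have sumE (c : 'I_(n + n) -> R) :
    \sum_i of_real ComplexScalars (c i) *: s i =
    \sum_j (of_real ComplexScalars (c (lshift n j)) +
            ii * of_real ComplexScalars (c (rshift n j))) *: b j.
  rewrite big_split_ord /= -big_split /=; apply: eq_bigr => j _ /=.
  by rewrite sl sr scalerDl scalerA [ii * _]mulrC.
exists (n + n)%N, s; split.
- by rewrite mul2n addnn.
- move=> v; split=> [[c ->]|[c ->]]; last by rewrite sumE; eexists.
  exists (fun i => match fintype.split i with
                   | inl j => sre (c j) | inr j => sim (c j) end).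
  rewrite sumE; apply: eq_bigr => j _.
  by rewrite (unsplitK (inl j)) (unsplitK (inr j)) -scalarE.
- move=> indep c; rewrite sumE => /indep c0 i.
  have {}c0 j : c (lshift n j) = 0 /\ c (rshift n j) = 0.
    have := c0 j; move: (c _) (c _) => x y [].
    by rewrite !(mul0r, mul1r, subr0, addr0, add0r) => -> ->.
  by case: (split_ordP i) => j ->; have [] := c0 j.
(* The minus sign comes from Re(i z) = - Im z: the real part prescribed at [ii *: b j] is minus the
   imaginary part of [f (b j)]. *)
move=> u; exists (fun j => of_real ComplexScalars (u (lshift n j)) -
  ii * of_real ComplexScalars (u (rshift n j))) => f flin fb i.
case: (split_ordP i) => j ->.
  by rewrite sl fb sreB si sim_of_real oppr0 subr0 sre_of_real.
have fZ (a : scalars R ComplexScalars) x : f (a *: x) = a * f x.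
  have f0 : f 0 = 0 by apply: (addrI (f 0)); rewrite -{1}[f 0]scale1r -flin
    scale1r !addr0.
  by rewrite -[a *: x]addr0 flin f0 addr0.
rewrite sr fZ fb mulrBr mulrA ii2 mulN1r opprK sreD si sim_of_real.
by rewrite oppr0 add0r sre_of_real.
Qed.

End RealBasis.

(** * Finite-dimensional normed spaces in real coordinates *)

Lemma coord_le_norm (R : realType) m (v : 'rV[R]_m) i : `|v 0 i| <= `|v|.
Proof.
by rewrite [leRHS]/Num.norm /= mx_normrE; apply/bigmax_geP; right;
  exists (0, i).
Qed.

Lemma norm_le_coord (R : realType) m (v : 'rV[R]_m) (M : R) : 0 <= M ->
  (forall i, `|v 0 i| <= M) -> `|v| <= M.
Proof.
move=> M0 vM; rewrite [leLHS]/Num.norm /= mx_normrE; apply/bigmax_leP.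
by split=> // -[i j] _ /=; rewrite (ord1 i).
Qed.

Section LinearMaps.
Variables (K : pzRingType) (D E : lmodType K) (f : D -> E).
Hypothesis flin : linear f.

Lemma linear_map0 : f 0 = 0.
Proof.
by apply: (addrI (f 0)); rewrite -{1}[f 0]scale1r -flin scale1r !addr0.
Qed.

Lemma linear_mapZ (a : K) x : f (a *: x) = a *: f x.
Proof. by rewrite -[a *: x]addr0 flin linear_map0 addr0. Qed.

Lemma linear_mapD x y : f (x + y) = f x + f y.
Proof. by rewrite -[x in LHS]scale1r flin scale1r. Qed.

Lemma linear_map_sum (I : finType) (x : I -> D) : f (\sum_i x i) = \sum_i f (x
  i).
Proof.
elim: (index_enum I) => [|i s IHs]; first by rewrite !big_nil linear_map0.
by rewrite !big_cons linear_mapD IHs.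
Qed.

End LinearMaps.

Section FiniteDimension.
Variables (R : realType) (k : scalar_kind).
Local Notation F := (scalars R k).
Variable X : completeNormedModType F.
Local Notation ii := (iunit R k).

(** Since [sup] takes a default value on unbounded sets, this is required before [dual_norm] can
    serve as an upper bound. *)
Lemma dual_bounded (f : X -> F^o) : dual f ->
  has_ubound [set sre `|f x| | x in @unit_ball R k X].
Proof.
move=> [_ [M fM]]; exists (sre `|M|) => _ [x xB <-].
rewrite -(ler_of_real k) !sreK //; apply: le_trans (fM x) _.
rewrite -[M * _]ger0_norm ?(le_trans _ (fM x)) // normrM normr_id.
by rewrite -[leRHS]mulr1 ler_wpM2l.
Qed.

Lemma contraction_of_unit_ball (f : X -> F^o) : linear f ->
  (forall x, sre `|x| <= 1 -> sre `|f x| <= 1) -> forall x, `|f x| <= `|x|.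
Proof.
move=> flin f1 x.
have [->|x0] := eqVneq x 0; first by rewrite linear_map0 // !normr0.
have nx0 : 0 < sre `|x|.
  by rewrite lt_def sre_norm_ge0 andbT; apply: contra_neq x0 => /sre_norm_eq0.
rewrite -[`|x|]normK -[leLHS]sreK // ler_of_real.
have := f1 (of_real k (sre `|x|)^-1 *: x); rewrite (linear_mapZ flin).
rewrite !sre_normZ sre_norm_of_real.
rewrite ger0_norm ?invr_ge0 ?sre_norm_ge0 // mulVf ?gt_eqF // => /(_ (lexx 1)).
by rewrite ler_pdivrMl // mulr1.
Qed.

Lemma dual_ballP (f : X -> F^o) : dual_ball f <->
  linear f /\ forall x, sre `|x| <= 1 -> sre `|f x| <= 1.
Proof.
split=> [[fd f1]|[flin f1]].
  split=> [|x x1]; first by case: fd.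
  apply: le_trans f1; apply: ub_le_sup; first exact: dual_bounded.
  by exists x => //; rewrite /unit_ball /= norm_le1.
split; last first.
  apply: ge_sup.
    by exists (sre `|f 0|), 0 => //; rewrite /unit_ball /= normr0.
  by move=> _ [x xB <-]; apply: f1; rewrite -norm_le1.
split=> //; exists 1 => x; rewrite mul1r.
exact: contraction_of_unit_ball.
Qed.

Lemma dual_ball_le (f : X -> F^o) x : dual_ball f -> `|f x| <= `|x|.
Proof. by move=> /dual_ballP[flin f1]; exact: contraction_of_unit_ball. Qed.

(** The chain 1 = |f x| <= |x| <= 1, and its analogue for the dual norm, must be equalities. Hence
    the compact balls can stand in for the spheres. *)
Lemma dual_ball_sphere (f : X -> F^o) x : dual_ball f -> unit_ball x ->
  `|f x| = 1 -> dual_sphere f /\ unit_sphere x.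
Proof.
move=> fB x1 fx; split; last first.
  by apply/eqP; rewrite eq_le x1 -fx dual_ball_le.
case: (fB) => fd f1; split=> //; apply/eqP; rewrite eq_le f1 /=.
apply: ub_le_sup; first exact: dual_bounded.
by exists x => //; rewrite fx -(rmorph1 (@of_real R k)) sre_of_real.
Qed.

(* [e] is a basis of [X] over the reals; [e_dual] says that an F-linear
   functional can have arbitrary real parts on it. *)
Variables (m : nat) (e : 'I_m -> X).
Hypothesis e_span : forall x, exists c : 'rV[R]_m, x = \sum_i of_real k (c 0
  i) *: e i.
Hypothesis e_indep : forall c : 'rV[R]_m,
  \sum_i of_real k (c 0 i) *: e i = 0 -> c = 0.
Hypothesis e_dual : forall u : 'rV[R]_m, exists f : X -> F^o,
  linear f /\ forall i, sre (f (e i)) = u 0 i.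

Definition vec (v : 'rV[R]_m) : X := \sum_i of_real k (v 0 i) *: e i.

Definition coords (x : X) : 'rV[R]_m := projT1 (cid (e_span x)).

(** Real coordinates on the dual: the row [u] is the real part of an F-linear functional, which it
    determines. *)
Definition func (u : 'rV[R]_m) : X -> F^o := projT1 (cid (e_dual u)).

Local Notation dot u v := ((u *m v^T) 0 0).

Lemma coordsK x : vec (coords x) = x.
Proof. by rewrite /vec /coords; case: cid => c /= <-. Qed.

Lemma vecB v w : vec (v - w) = vec v - vec w.
Proof.
rewrite /vec -sumrB; apply: eq_bigr => i _.
by rewrite !mxE rmorphB /= scalerBl.
Qed.

Lemma vecZ a v : vec (a *: v) = of_real k a *: vec v.
Proof.
rewrite /vec scaler_sumr; apply: eq_bigr => i _.
by rewrite !mxE rmorphM /= scalerA.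
Qed.

Lemma vecD v w : vec (v + w) = vec v + vec w.
Proof.
rewrite /vec -big_split; apply: eq_bigr => i _ /=.
by rewrite !mxE rmorphD /= scalerDl.
Qed.

Lemma vec_inj : injective vec.
Proof.
move=> v w vw; apply/eqP; rewrite -subr_eq0; apply/eqP/e_indep.
by rewrite -/(vec _) vecB vw subrr.
Qed.

Lemma func_linear u : linear (func u).
Proof. by rewrite /func; case: cid => f []. Qed.

Lemma sre_linear_vec (f : X -> F^o) v : linear f ->
  sre (f (vec v)) = \sum_i v 0 i * sre (f (e i)).
Proof.
move=> flin; rewrite /vec linear_map_sum // sre_sum; apply: eq_bigr => i _.
by rewrite linear_mapZ // -sreMl.
Qed.

Lemma sre_func u v : sre (func u (vec v)) = dot u v.
Proof.
rewrite sre_linear_vec; last exact: func_linear.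
rewrite mxE; apply: eq_bigr => i _.
by rewrite mxE mulrC /func; case: cid => f [_ /= ->].
Qed.

(** Real parts on a real basis suffice, because Im f(x) = - Re f(i x). *)
Lemma linear_functional_eq (f g : X -> F^o) : linear f -> linear g ->
  (forall i, sre (f (e i)) = sre (g (e i))) -> f = g.
Proof.
move=> flin glin fg.
have E x : sre (f x) = sre (g x).
  rewrite -(coordsK x) !sre_linear_vec //.
  by apply: eq_bigr => i _; rewrite fg.
apply/funext => x; apply: scalar_eq; first exact: E.
by rewrite !simE; rewrite -[_ * f x](linear_mapZ flin)
  -[_ * g x](linear_mapZ glin) E.
Qed.

Definition dual_coords (f : X -> F^o) : 'rV[R]_m := \row_i sre (f (e i)).

Lemma dual_coordsK f : linear f -> func (dual_coords f) = f.
Proof.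
move=> flin; apply: linear_functional_eq => // [|i]; first exact: func_linear.
by rewrite /func; case: cid => g [_ /= ->]; rewrite mxE.
Qed.

Lemma sre_func_op (A : X -> X) u v : linear A ->
  sre (func u (A (vec v))) = \sum_i v 0 i * dot u (coords (A (e i))).
Proof.
move=> Alin; have flin := @func_linear u.
rewrite /vec linear_map_sum // linear_map_sum // sre_sum.
apply: eq_bigr => i _; rewrite linear_mapZ // linear_mapZ // -sre_func coordsK.
exact: sreMl.
Qed.

(** In coordinates this is a bilinear form in the two rows. *)
Lemma continuous_func_op (A : X -> X) : linear A ->
  continuous (fun w : 'rV[R]_m * 'rV[R]_m => sre (func w.1 (A (vec w.2)))).
Proof.
move=> Alin.
rewrite (_ : (fun _ => _) = (fun w : 'rV[R]_m * 'rV[R]_m => \sum_i w.2 0 i *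
    (\sum_j w.1 0 j * (coords (A (e i))) 0 j))).
  have c2 i : continuous (fun w : 'rV[R]_m * 'rV[R]_m => w.2 0 i).
    move=> w; apply: (@continuous_comp _ _ _ snd (fun M : 'rV[R]_m => M 0 i) w).
      exact: cvg_snd.
    exact: coord_continuous.
  have c1 i : continuous (fun w : 'rV[R]_m * 'rV[R]_m => w.1 0 i).
    move=> w; apply: (@continuous_comp _ _ _ fst (fun M : 'rV[R]_m => M 0 i) w).
      exact: cvg_fst.
    exact: coord_continuous.
  apply: continuous_sum => i w; apply: continuousM; first exact: c2.
  apply: continuous_sum => j {}w; apply: continuousM; first exact: c1.
  exact: cst_continuous.
apply/funext => w; rewrite sre_func_op //; apply: eq_bigr => i _.
by rewrite mxE; congr (_ * _); apply: eq_bigr => j _; rewrite [X in _ * X]mxE.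
Qed.

Definition nrm v := sre `|vec v|.
Definition coord_ball : set 'rV[R]_m := [set v | nrm v <= 1].
(** The polar of [coord_ball] for the real pairing: an intersection of half-spaces, so that
    closedness and convexity are immediate. *)
Definition coord_dual_ball : set 'rV[R]_m :=
  [set u | forall v, coord_ball v -> dot u v <= 1].

Let cst := \sum_i sre `|e i|.

Lemma nrm_le v : nrm v <= cst * `|v|.
Proof.
apply: (@le_trans _ _ (\sum_i `|v 0 i| * sre `|e i|)).
  rewrite /nrm /vec; elim/big_ind2 : _ => [|x a y b xa yb|i _].
  - by rewrite normr0 -(rmorph0 (@of_real R k)) sre_of_real.
  - by apply: le_trans (sre_normD _ _) _; exact: lerD.
  by rewrite sre_normZ sre_norm_of_real.
rewrite mulr_suml; apply: ler_sum => i _.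
by rewrite mulrC ler_wpM2l ?sre_norm_ge0 // coord_le_norm.
Qed.

Lemma cst_ge0 : 0 <= cst.
Proof. by apply: sumr_ge0 => i _; exact: sre_norm_ge0. Qed.

Lemma nrm_dist v w : `|nrm v - nrm w| <= nrm (v - w).
Proof.
have nB v' w' : nrm v' - nrm w' <= nrm (v' - w').
  rewrite lerBlDr -{1}[v'](subrK w') /nrm [X in sre `|X| <= _]vecD.
  exact: sre_normD.
rewrite ler_norml nB andbT lerNl opprB (_ : nrm (v - w) = nrm (w - v)) //.
by rewrite /nrm !vecB distrC.
Qed.

Lemma nrm_continuous : continuous nrm.
Proof.
move=> v; apply: (iffRL (@cvgrPdist_le R R^o 'rV[R]_m (nbhs v) _ nrm (nrm v))).
(* One is added because [cst] vanishes when [m = 0]. *)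
have c1 : 0 < cst + 1 by rewrite ltr_wpDl // cst_ge0.
move=> eps eps0; near=> w.
apply: le_trans (nrm_dist _ _) _; apply: le_trans (nrm_le _) _.
apply: (@le_trans _ _ ((cst + 1) * `|v - w|)).
  by rewrite ler_wpM2r // lerDl.
rewrite mulrC -ler_pdivlMr //; near: w.
apply: (cvgr_dist_le id v); [exact: cvg_id | by rewrite divr_gt0].
Unshelve. all: by end_near. Qed.

(** Equivalence of norms: on the unit sphere of the sup norm, [nrm] has a positive lower bound [d],
    so [coord_ball] lies in the ball of radius [d^-1]. When [m = 0] the sphere is empty and [d = 1]
    is taken. *)
Lemma compact_coord_ball : compact coord_ball.
Proof.
have clB : closed coord_ball.
  rewrite (_ : coord_ball = nrm @^-1` [set r | r <= 1]) //.
  by apply: preimage_closed; [move=> v _; exact: nrm_continuous | exact: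
    closed_le].
pose S := [set v : 'rV[R]_m | `|v| = 1].
have cS : compact S.
  apply: bounded_closed_compact.
    exists 1; split=> //.
    by move=> M M1 v /= ->; exact: ltW.
  rewrite (_ : S = (fun v : 'rV[R]_m => `|v|) @^-1` [set 1]) //.
  apply: preimage_closed; last exact: closed_eq.
  by move=> v _; exact: norm_continuous.
have nrmZ a v : nrm (a *: v) = `|a| * nrm v.
  by rewrite /nrm vecZ sre_normZ sre_norm_of_real.
have [d d0 Sd] : exists2 d, 0 < d & forall v, S v -> d <= nrm v.
  have [S0|S0] := pselect (S !=set0); last first.
    by exists 1 => // v Sv; case: S0; exists v.
  have [c] := EVT_min_rV S0 cS (continuous_subspaceT nrm_continuous).
  rewrite inE => Sc cmin; exists (nrm c) => [|v Sv]; last by apply: cmin;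
    rewrite inE.
  rewrite lt_def sre_norm_ge0 andbT; apply/eqP => c0.
  move: Sc; rewrite /S /= (_ : c = 0) ?normr0 => [/esym/eqP|].
    by rewrite oner_eq0.
  apply: vec_inj; rewrite (sre_norm_eq0 c0) /vec big1 // => i _.
  by rewrite mxE rmorph0 scale0r.
apply: bounded_closed_compact => //; exists d^-1; split; first exact: num_real.
move=> M dM v vB; apply: le_trans (ltW dM).
have [->|v0] := eqVneq v 0; first by rewrite normr0 invr_ge0 ltW.
have v0' : 0 < `|v| by rewrite normr_gt0.
have := Sd (`|v|^-1 *: v); rewrite nrmZ /S /= normrZ normfV normr_id mulVf
  ?gt_eqF //.
move=> /(_ erefl); rewrite ler_pdivlMl // => /le_trans/(_ vB) dv.
by rewrite -(ler_pM2r d0) mulVf ?gt_eqF.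
Qed.

Lemma coord_ballE v : coord_ball v <-> unit_ball (vec v).
Proof. by rewrite /unit_ball /coord_ball /= norm_le1. Qed.

(** Bounding real parts is enough: multiplying [x] by a scalar of modulus 1 keeps it in the ball and
    turns the value of [func u] into its modulus. *)
Lemma coord_dual_ballE u : coord_dual_ball u <-> dual_ball (func u).
Proof.
have flin := @func_linear u.
rewrite dual_ballP; split=> [uU|[_ u1] v v1]; last first.
  by rewrite -sre_func (le_trans (ler_sre_norm _)) // u1.
split=> // x x1; have [l l1 lf] := rotation (func u x).
have := uU (coords (l *: x)); rewrite -sre_func coordsK (linear_mapZ flin).
rewrite (lf : l *: (func u x : F^o) = _); apply;
  rewrite /coord_ball /= /nrm coordsK sre_normZ l1.
by rewrite -(rmorph1 (@of_real R k)) sre_of_real mul1r.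
Qed.

Lemma compact_coord_dual_ball : compact coord_dual_ball.
Proof.
apply: bounded_closed_compact; last first.
  rewrite (_ : coord_dual_ball =
      \bigcap_(v in coord_ball) ((fun u => dot u v) @^-1` [set r | r <= 1])) //.
  apply: closed_bigI => v _; apply: preimage_closed; last exact: closed_le.
  by move=> u _; exact: dot_continuous.
have c1 : 0 < cst + 1 by rewrite ltr_wpDl // cst_ge0.
exists (cst + 1); split; first exact: num_real.
move=> M cM u uU; apply: le_trans (ltW cM).
apply: norm_le_coord => [|i]; first exact: ltW.
(* Test [u] against [s / (cst + 1)] times the [i]-th basis row, which lies in [coord_ball] by
   [nrm_le]; [s] will be 1 and -1. *)
have half (s : R) : `|s| = 1 -> s * u 0 i <= cst + 1.
  move=> s1; pose v : 'rV[R]_m := (s / (cst + 1)) *: delta_mx 0 i.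
  have := uU v; rewrite /v linearZ /= -scalemxAr mxE.
  have -> : dot u (delta_mx 0 i : 'rV[R]_m) = u 0 i.
    rewrite mxE (bigD1 i) //= big1 ?addr0.
      by rewrite !mxE !eqxx mulr1.
    by move=> j ji; rewrite !mxE (negPf ji) andbF mulr0.
  rewrite mulrAC ler_pdivrMr // mul1r; apply.
  apply: le_trans (nrm_le _) _.
  have : `|v| <= (cst + 1)^-1.
    apply: norm_le_coord => [|j]; first by rewrite invr_ge0 ltW.
    rewrite !mxE normrM normrM s1 mul1r ger0_norm ?invr_ge0 ?(ltW c1) //.
    case: (_ && _); first by rewrite normr1 mulr1.
    by rewrite normr0 mulr0 invr_ge0 ltW.
  move=> /(ler_wpM2l cst_ge0)/le_trans; apply.
  by rewrite ler_pdivrMr // mul1r lerDl.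
rewrite ler_norml lerNl -mulN1r half ?normrN1 //=.
by rewrite -[u 0 i]mul1r half ?normr1.
Qed.

Lemma dual_coords_func u : dual_coords (func u) = u.
Proof.
by apply/rowP => i; rewrite mxE /func; case: cid => f [_ /= ->].
Qed.

Lemma real_parameter (t : F) : 0 < t < 1 ->
  exists2 s : R, t = of_real k s & 0 < s < 1.
Proof.
move=> /andP[t0 t1]; exists (sre t); first by rewrite sreK // ltW.
by rewrite -!(ltr_of_real k) sreK ?ltW // rmorph0 rmorph1 t0.
Qed.

Lemma extreme_vec v : extreme_points coord_ball v -> extreme_points
  (@unit_ball R k X) (vec v).
Proof.
move=> [vB vext]; split=> [|y z t yB zB /real_parameter[s -> s01] vE].
  exact/coord_ballE.
have [||||yv zv] := vext (coords y) (coords z) s; rewrite ?coordsK //.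
- by apply/coord_ballE; rewrite coordsK.
- by apply/coord_ballE; rewrite coordsK.
- by apply: vec_inj; rewrite vE vecD !vecZ !coordsK rmorphB rmorph1.
by rewrite -[X in y = vec X]yv -[X in z = vec X]zv !coordsK.
Qed.

Lemma extreme_func u : extreme_points coord_dual_ball u ->
  extreme_points (@dual_ball R k X) (func u).
Proof.
move=> [uU uext]; split=> [|g h t gU hU /real_parameter[s -> s01] uE].
  exact/coord_dual_ballE.
have [glin _] := (dual_ballP g).1 gU; have [hlin _] := (dual_ballP h).1 hU.
have [||||gu hu] := uext (dual_coords g) (dual_coords h) s;
  rewrite ?dual_coordsK //.
- by apply/coord_dual_ballE; rewrite dual_coordsK.
- by apply/coord_dual_ballE; rewrite dual_coordsK.
- rewrite -[LHS]dual_coords_func uE; apply/rowP => i; rewrite !mxE.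
  rewrite -(rmorph1 (@of_real R k)) -rmorphB /=.
  by rewrite (sreD (of_real k (1 - s) * g (e i))) !sreMl.
by rewrite -[X in g = func X]gu -[X in h = func X]hu !dual_coordsK.
Qed.

Lemma convex_coord_ball : is_convex coord_ball.
Proof.
move=> v w s vB wB /andP[s0 s1].
rewrite /coord_ball /= segmentE /nrm vecD !vecZ.
apply: le_trans (sre_normD _ _) _; rewrite !sre_normZ !sre_norm_of_real.
by rewrite !ger0_norm ?subr_ge0 //; move: vB wB; rewrite /coord_ball /= /nrm;
  nra.
Qed.

Lemma convex_coord_dual_ball : is_convex coord_dual_ball.
Proof.
move=> u w s uU wU /andP[s0 s1] v vB; rewrite mulmxDl mxE dotZl dotBl.
by have := uU v vB; have := wU v vB; nra.
Qed.

Lemma compact_pairs : compact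
  [set w : 'rV[R]_m * 'rV[R]_m | [/\ coord_dual_ball w.1, coord_ball w.2
                                   & `|func w.1 (vec w.2)| = 1]].
Proof.
set P := [set w | _].
pose re (w : 'rV[R]_m * 'rV[R]_m) := sre (func w.1 (idfun (vec w.2))).
(* This is the imaginary part up to sign, written as a real part so that [continuous_func_op] covers
   it; over the reals it is zero. *)
pose im (w : 'rV[R]_m * 'rV[R]_m) := sre (func w.1 (ii *: vec w.2)).
have cre : continuous re by apply: continuous_func_op.
have cim : continuous im.
  by apply: (@continuous_func_op (fun x => ii *: x)) => a x y;
    rewrite scalerDr !scalerA mulrC.
have normE w : `|func w.1 (vec w.2)| = 1 <-> re w * re w + im w * im w = 1.
  rewrite norm_eq1 simE -[_ * func _ _](linear_mapZ (@func_linear _)).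
  by rewrite sqrrN !expr2.
rewrite (_ : P = (coord_dual_ball `*` coord_ball) `&`
    (fun w => re w * re w + im w * im w) @^-1` [set 1]); last first.
  apply/seteqP; split=> w; first by case=> ? ? /normE.
  by case=> -[? ?] /normE.
have cn : continuous (fun w => re w * re w + im w * im w).
  by move=> w; apply: (@continuousD R R^o _ (fun w => re w * re w)
    (fun w => im w * im w)); apply: continuousM;
    [exact: cre | exact: cre | exact: cim | exact: cim].
have cUB := compact_setX compact_coord_dual_ball compact_coord_ball.
apply: (subclosed_compact _ cUB) => [|w []//].
apply: closedI.
  by apply: compact_closed cUB; exact: norm_hausdorff.
apply: preimage_closed; last exact: closed_eq.
by move=> w _; exact: cn.
Qed.

(** The real-linear condition Re(l z) = 1 certifies |z| = 1. Thus the norming condition survives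
    when one member of a pair is replaced within a face. *)
Lemma unimodular (l z : F) : `|l| = 1 -> sre `|z| <= 1 ->
  sre (l * z) <= 1 /\ (sre (l * z) = 1 -> `|z| = 1).
Proof.
move=> l1 z1; have lz : sre (l * z) <= sre `|z|.
  by rewrite (le_trans (ler_sre_norm _)) // normrM l1 mul1r.
split; first exact: le_trans z1.
move=> lz1; rewrite -[`|z|]sreK // -[RHS](rmorph1 (@of_real R k));
  congr of_real.
by apply/eqP; rewrite eq_le z1 -lz1.
Qed.

Definition extreme_pair (f : X -> F^o) (x : X) :=
  [/\ extreme_points (@dual_ball R k X) f, extreme_points (@unit_ball R k X) x
    & `|f x| = 1].

Variables (q : nat) (A : 'I_q -> X -> X).
Hypothesis Alin : forall j, linear (A j).

Definition values (f : X -> F^o) (x : X) : 'rV[R]_q := \row_j sre (f (A j x)).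

Definition extreme_values : set 'rV[R]_q :=
  [set z | exists f x, extreme_pair f x /\ z = values f x].

Lemma values_func_segment u w v s : values (func (u + s *: (w - u))) (vec v) =
  values (func u) (vec v) + s *: (values (func w) (vec v) - values (func u)
    (vec v)).
Proof.
apply/rowP => j; rewrite !mxE -(coordsK (A j (vec v))) !sre_func.
by rewrite mulmxDl mxE dotZl dotBl.
Qed.

Lemma values_vec_segment u v w s : values (func u) (vec (v + s *: (w - v))) =
  values (func u) (vec v) + s *: (values (func u) (vec w) - values (func u)
    (vec v)).
Proof.
have flin := @func_linear u.
apply/rowP => j; rewrite !mxE vecD vecZ vecB.
rewrite (linear_mapD (Alin j)) (linear_mapZ (Alin j)) -scaleN1r.
rewrite (linear_mapD (Alin j)) (linear_mapZ (Alin j)).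
rewrite !((linear_mapD flin), (linear_mapZ flin)) sreD.
by rewrite (sreMl s) sreD -(rmorphN1 (@of_real R k)) (sreMl (-1)) mulN1r.
Qed.

Lemma values_hull u v : coord_dual_ball u -> coord_ball v ->
  `|func u (vec v)| = 1 ->
  convex_hull extreme_values (values (func u) (vec v)).
Proof.
move=> uU vB; set l := func u (vec v) => l1 D vD ED.
have l0 : l != 0 by rewrite -normr_eq0 l1 oner_eq0.
have lV : `|l^-1| = 1 by rewrite normfV l1 invr1.
(* Dividing by the phase [l] makes pairing with [c] a functional that is at most 1 on the dual ball
   and equals 1 at [u]. *)
pose c := coords (l^-1 *: vec v).
have dotc y : dot y c = sre (l^-1 * func y (vec v)).
  by rewrite -sre_func coordsK (linear_mapZ (@func_linear y)).
have ball_le1 y z : coord_dual_ball y -> coord_ball z ->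
    sre `|func y (vec z)| <= 1.
  by move=> /coord_dual_ballE/dual_ballP[_]; exact.
have Uc y : coord_dual_ball y -> dot y c <= 1.
  by move=> yU; rewrite dotc; have [] := unimodular lV (ball_le1 _ _ yU vB).
(* For fixed [v] the values are affine in the functional, so the preimage of [D] is convex and only
   extreme functionals [y] of the face remain. *)
apply: (face_minkowski compact_coord_dual_ball convex_coord_dual_ball Uc uU _
  (D := fun y => D (values (func y) (vec v)))).
- rewrite dotc mulVf //.
  by rewrite -(rmorph1 (@of_real R k)) sre_of_real.
- by move=> y z s Dy Dz s01; rewrite values_func_segment; exact: vD.
move=> y [yext]; have yU := yext.1; rewrite dotc.
move=> /(unimodular lV (ball_le1 _ _ yU vB)).2.
set r := func y (vec v) => r1.
have r0 : r != 0 by rewrite -normr_eq0 r1 oner_eq0.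
have rV : `|r^-1| = 1 by rewrite normfV r1 invr1.
(* The same argument with the roles exchanged: [y] is now fixed, and the phase is that of the new
   value [r]. *)
pose d := dual_coords (r^-1 *: func y).
have dotd z : dot z d = sre (r^-1 * func y (vec z)).
  rewrite dotC -sre_func dual_coordsK // => a x x'.
  change (r^-1 *: func y (a *: x + x') =
    a *: (r^-1 *: func y x) + r^-1 *: func y x' :> F^o).
  by rewrite (@func_linear y) scalerDr !scalerA mulrC.
have Bd z : coord_ball z -> dot z d <= 1.
  by move=> zB; rewrite dotd; have [] := unimodular rV (ball_le1 _ _ yU zB).
apply: (face_minkowski compact_coord_ball convex_coord_ball Bd vB _
  (D := fun z => D (values (func y) (vec z)))).
- rewrite dotd mulVf //.
  by rewrite -(rmorph1 (@of_real R k)) sre_of_real.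
- by move=> z w s Dz Dw s01; rewrite values_vec_segment; exact: vD.
move=> z [zext]; have zB := zext.1; rewrite dotd.
move=> /(unimodular rV (ball_le1 _ _ yU zB)).2 yz1.
apply: ED; exists (func y), (vec z); split=> //.
by split; [exact: extreme_func | exact: extreme_vec | exact: yz1].
Qed.

(** By [support_hull], [p] is in the hull of the compact set of values at all norming pairs, and
    [values_hull] puts each of these values in the hull of the extreme ones. *)
Lemma support_extreme_values (p : 'rV[R]_q) :
  (exists f x, [/\ @dual_ball R k X f, @unit_ball R k X x & `|f x| = 1]) ->
  (forall (c : 'cV_q) b,
    (forall f x, @dual_ball R k X f -> @unit_ball R k X x -> `|f x| = 1 ->
      (values f x *m c) 0 0 <= b) ->
    (p *m c) 0 0 <= b) ->
  convex_hull extreme_values p.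
Proof.
move=> [f0 [x0 [f0B x0B fx0]]] supp.
pose val (w : 'rV[R]_m * 'rV[R]_m) := values (func w.1) (vec w.2).
have cval : continuous val.
  rewrite (_ : val = (fun w => \sum_j sre (func w.1 (A j (vec w.2))) *:
      (delta_mx 0 j : 'rV[R]_q))).
    apply: continuous_sum => j w; apply: cvgZr_tmp.
    exact: continuous_func_op.
  apply/funext => w; rewrite [LHS]row_sum_delta; apply: eq_bigr => j _.
  by rewrite mxE.
have pair_coords f x : @dual_ball R k X f -> @unit_ball R k X x -> `|f x| = 1 ->
    exists w, [/\ coord_dual_ball w.1, coord_ball w.2,
      `|func w.1 (vec w.2)| = 1 & values f x = val w].
  move=> fB xB fx; have [flin _] := (dual_ballP f).1 fB.
  exists (dual_coords f, coords x); rewrite /val /= dual_coordsK // coordsK.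
  split=> //; first by apply/coord_dual_ballE; rewrite dual_coordsK.
  by apply/coord_ballE; rewrite coordsK.
have hullP := support_hull (continuous_compact (continuous_subspaceT cval)
  compact_pairs).
move=> D vD ED; apply: (hullP p) => //.
- have [w [w1 w2 w3 _]] := pair_coords _ _ f0B x0B fx0.
  by exists (val w), w.
- move=> c b cb; apply: supp => f x fB xB fx.
  have [w [w1 w2 w3 ->]] := pair_coords _ _ fB xB fx.
  by apply: cb; exists w.
by move=> _ [[u v] [uU vB uv] <-]; exact: values_hull vD ED.
Qed.

End FiniteDimension.

Section RealBasisOfSpace.
Variables (R : realType) (k : scalar_kind).
Local Notation F := (scalars R k).

Lemma linear_extension (E : lmodType F) n (b : 'I_n -> E) (y : 'I_n -> F) :
  lin_indep b -> (forall x, lin_span b x) ->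
  exists f : E -> F^o, linear f /\ forall j, f (b j) = y j.
Proof.
move=> indep span; have [c cE] := choice span.
have uniq (a a' : 'I_n -> F) :
    \sum_i a i *: b i = \sum_i a' i *: b i -> forall i, a i = a' i.
  move=> aa i; apply/eqP; rewrite -subr_eq0; apply/eqP.
  apply: (indep (fun i => a i - a' i)).
  by under eq_bigr do rewrite scalerBl; rewrite sumrB aa subrr.
exists (fun x => \sum_i c x i * y i); split=> [a x x'|j].
  have cD i : c (a *: x + x') i = a * c x i + c x' i.
    apply: (uniq _ (fun i => a * c x i + c x' i)).
    rewrite -cE {1}[x]cE {1}[x']cE scaler_sumr -big_split;
      apply: eq_bigr => l _.
    by rewrite scalerDl scalerA.
  rewrite [X in _ = X + _]mulr_sumr -big_split; apply: eq_bigr => i _ /=.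
  by rewrite cD mulrDl mulrA.
have cb i : c (b j) i = (i == j)%:R.
  apply: (uniq _ (fun i => (i == j)%:R)); rewrite -cE (bigD1 j) //= eqxx
    scale1r.
  by rewrite big1 ?addr0 // => l /negPf ->; rewrite scale0r.
rewrite (bigD1 j) //= cb eqxx mul1r big1 ?addr0 // => l /negPf lj.
by rewrite cb lj mul0r.
Qed.

Lemma support_extreme_pairs (X : completeNormedModType F) q
    (A : 'I_q -> X -> X) (p : 'rV[R]_q) :
  finite_dimensional X -> (forall j, linear (A j)) ->
  (exists f x, [/\ @dual_ball R k X f, @unit_ball R k X x & `|f x| = 1]) ->
  (forall (c : 'cV_q) b,
    (forall f x, @dual_ball R k X f -> @unit_ball R k X x -> `|f x| = 1 ->
      (values A f x *m c) 0 0 <= b) ->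
    (p *m c) 0 0 <= b) ->
  convex_hull (extreme_values A) p.
Proof.
move=> [N [b [indep Xb]]] Alin.
have span x : lin_span b x by rewrite -Xb.
have [m [e [_ e_span e_indep e_dual]]] := real_family b.
apply: (@support_extreme_values R k X m e) => //.
- move=> x; have [c ->] := (e_span x).1 (span x); exists (\row_i c i).
  by apply: eq_bigr => i _; rewrite mxE.
- by move=> c c0; apply/rowP => i; rewrite mxE; exact: e_indep indep _ c0 i.
move=> u; have [y yE] := e_dual (fun i => u 0 i).
have [f [flin fb]] := linear_extension y indep span.
by exists f; split=> //; exact: yE.
Qed.

End RealBasisOfSpace.

(** * The numerical radius through norming pairs *)

Section NumericalRadius.
Variables (R : realType) (k : scalar_kind).
Local Notation F := (scalars R k).
Variable X : completeNormedModType F.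
Implicit Types (A S T : X -> X) (f : X -> F^o) (x : X).

Lemma dual_ballZ (l : F) f : `|l| = 1 -> dual_ball f -> dual_ball (l *: f).
Proof.
move=> l1 /dual_ballP[flin f1]; apply/dual_ballP; split=> [a x y|x x1].
  change (l *: f (a *: x + y) = a *: (l *: f x) + l *: f y :> F^o).
  by rewrite flin scalerDr !scalerA mulrC.
change (sre `|l * f x| <= 1).
by rewrite normrM l1 mul1r f1.
Qed.

Lemma operatorsZ (a : F) T : operators T -> operators (a *: T).
Proof.
move=> [Tlin [M TM]]; split.
  move=> c x y; change (a *: T (c *: x + y) = c *: (a *: T x) + a *: T y).
  by rewrite Tlin scalerDr !scalerA mulrC.
exists (`|a| * M) => x; change (`|a *: T x| <= `|a| * M * `|x|).
by rewrite normrZ -mulrA ler_wpM2l.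
Qed.

Lemma operatorsD S T : operators S -> operators T -> operators (S + T).
Proof.
move=> [Slin [M SM]] [Tlin [N TN]]; split.
  move=> c x y.
  change (S (c *: x + y) + T (c *: x + y) = c *: (S x + T x) + (S y + T y)).
  by rewrite Slin Tlin scalerDr addrACA.
exists (M + N) => x; change (`|S x + T x| <= (M + N) * `|x|).
by rewrite (le_trans (ler_normD _ _)) // mulrDl lerD.
Qed.

(** Dividing [f] by the unimodular scalar [f x] gives a pair as in the definition and leaves |f(T
    x)| unchanged. *)
Lemma le_numerical_radius T f x : operators T -> dual_ball f -> unit_ball x ->
  `|f x| = 1 -> sre `|f (T x)| <= numerical_radius T.
Proof.
move=> [_ [M TM]] fB xB fx.
have f0 : f x != 0 by rewrite -normr_eq0 fx oner_eq0.
have lV : `|(f x)^-1| = 1 by rewrite normfV fx invr1.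
pose g := (f x)^-1 *: f.
have gB : dual_ball g by exact: dual_ballZ.
have gx : g x = 1 by change ((f x)^-1 * f x = 1); rewrite mulVf.
have [gS xS] := dual_ball_sphere gB xB (etrans (congr1 _ gx) (normr1 _)).
apply: ub_le_sup; last first.
  exists g, x; split=> //.
  change (sre `|f (T x)| = sre `|(f x)^-1 * f (T x)|).
  by rewrite normrM lV mul1r.
exists (sre M) => _ [h [y [[hd h1] yS hy ->]]].
have : `|h (T y)| <= M.
  apply: le_trans (dual_ball_le _ _) _; first by split=> //; rewrite h1.
  by have := TM y; rewrite yS mulr1.
move=> hM; have M0 : 0 <= M by exact: le_trans hM.
by rewrite -(ler_of_real k) !sreK.
Qed.

(** Rotating [f] makes f(T x) equal to its modulus, so real parts suffice. The given pair makes the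
    set nonempty; the [sup] of the empty set is 0, which need not be below [b]. *)
Lemma numerical_radius_le T (b : R) :
  (exists f x, [/\ @dual_ball R k X f, @unit_ball R k X x & `|f x| = 1]) ->
  (forall f x, dual_ball f -> unit_ball x -> `|f x| = 1 -> sre (f (T x)) <= b)
    ->
  numerical_radius T <= b.
Proof.
move=> [f0 [x0 [f0B x0B fx0]]] Tb; apply: ge_sup.
  have f00 : f0 x0 != 0 by rewrite -normr_eq0 fx0 oner_eq0.
  have gB : dual_ball ((f0 x0)^-1 *: f0).
    by apply: dual_ballZ => //; rewrite normfV fx0 invr1.
  have gx : ((f0 x0)^-1 *: f0) x0 = 1.
    by change ((f0 x0)^-1 * f0 x0 = 1); rewrite mulVf.
  have [gS xS] := dual_ball_sphere gB x0B (etrans (congr1 _ gx) (normr1 _)).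
  by eexists; exists ((f0 x0)^-1 *: f0), x0.
move=> _ [f [x [[fd f1] xS fx ->]]].
have [l l1 lf] := rotation (f (T x)).
have fB : dual_ball f by split=> //; rewrite f1.
have xB : unit_ball x by rewrite /unit_ball /= xS.
rewrite -lf; apply: (Tb (l *: f) x) => //; first exact: dual_ballZ.
by change (`|l * f x| = 1); rewrite fx mulr1.
Qed.

(** Without such a pair the numerical radius would be the [sup] of the empty set, that is 0, at the
    nonzero operator [T]. *)
Lemma exists_unimodular_pair T : numerical_radius_is_norm X -> operators T ->
  T <> 0 -> exists f x, [/\ @dual_ball R k X f, @unit_ball R k X x & `|f x| =
    1].
Proof.
move=> [_ w0 _ _] TL T0; apply: contrapT => no; apply: T0; apply: w0 => //.
rewrite /numerical_radius (_ : [set _ | _] = set0) ?sup0 //.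
apply/seteqP; split=> // r [f [x [[fd f1] xS fx _]]]; apply: no.
exists f, x; split; [by split=> //; rewrite f1 | by rewrite /unit_ball /= xS|].
by rewrite fx normr1.
Qed.

End NumericalRadius.

(** * Distance to a subspace of operators *)

Section Distance.
Variables (R : realType) (k : scalar_kind).
Local Notation F := (scalars R k).
Variable X : completeNormedModType F.
Hypothesis wnorm : numerical_radius_is_norm X.
Variables (n : nat) (b : 'I_n -> X -> X).
Local Notation V := (lin_span b).
Hypothesis VL : V `<=` @operators R k X.
Variable T : X -> X.
Hypothesis TL : operators T.

Lemma lin_span0 : V 0.
Proof.
by exists (fun=> 0); rewrite big1 // => i _; rewrite scale0r.
Qed.

Lemma lin_spanZ (a : F) S : V S -> V (a *: S).
Proof.
move=> [c ->]; exists (fun i => a * c i).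
by rewrite scaler_sumr; apply: eq_bigr => i _; rewrite scalerA.
Qed.

Lemma operatorsB S : V S -> operators (T - S).
Proof.
by move=> VS; rewrite -scaleN1r; apply: operatorsD => //;
  apply/operatorsZ/VL.
Qed.

Lemma dist_w_le S : V S -> dist_w T V <= numerical_radius (T - S).
Proof.
move=> VS; apply: ge_inf; last by exists S.
by exists 0 => _ [S' VS' <-]; case: wnorm => + _ _ _; apply; exact: operatorsB.
Qed.

Lemma le_dist_w r : (forall S, V S -> r <= numerical_radius (T - S)) ->
  r <= dist_w T V.
Proof.
move=> rV; apply: lb_le_inf; last by move=> _ [S VS <-]; exact: rV.
by exists (numerical_radius (T - 0)), 0 => //; exact: lin_span0.
Qed.

Lemma dist_w_ge0 : 0 <= dist_w T V.
Proof.
by apply: le_dist_w => S VS; case: wnorm => + _ _ _; apply; exact: operatorsB.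
Qed.

(** For nonzero [a], homogeneity gives w(a T + S) = |a| w(T - S') with [S'] in the subspace. This is
    the lower bound on the support function. *)
Lemma dist_w_scale (a : R) S : V S ->
  a * dist_w T V <= numerical_radius (of_real k a *: T + S).
Proof.
case: wnorm => w0 _ wZ _ VS; have [->|a0] := eqVneq a 0.
  rewrite mul0r w0 //; apply: operatorsD; first exact: operatorsZ.
  exact: VL.
have ka0 : of_real k a != 0 by rewrite fmorph_eq0.
pose S' := (- (of_real k a)^-1) *: S.
have VS' : V S' by exact: lin_spanZ.
have -> : of_real k a *: T + S = of_real k a *: (T - S').
  by rewrite scalerBr scalerA mulrN divff // scaleN1r opprK.
rewrite wZ; last exact: operatorsB.
rewrite sre_norm_of_real (le_trans _ (ler_wpM2l _ (dist_w_le VS'))) //.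
by rewrite ler_wpM2r ?dist_w_ge0 // ler_norm.
Qed.

Variables (h : nat) (t : 'I_h -> R) (f : 'I_h -> X -> F^o) (x : 'I_h -> X).
Hypothesis t_ge0 : forall i, 0 <= t i.
Hypothesis t_sum : \sum_i t i = 1.
Hypothesis f_ball : forall i, dual_ball (f i).
Hypothesis x_ball : forall i, unit_ball (x i).
Hypothesis fx : forall i, `|f i (x i)| = 1.

Definition mean (S : X -> X) : F := \sum_i of_real k (t i) * f i (S (x i)).

Lemma mean_linear : linear (mean : (X -> X) -> F^o).
Proof.
move=> a S S'; rewrite /mean [X in _ = X + _]mulr_sumr -big_split;
  apply: eq_bigr => i _ /=.
have [flin _] := (dual_ballP (f i)).1 (f_ball i).
change (of_real k (t i) * f i (a *: S (x i) + S' (x i)) =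
  a * (of_real k (t i) * f i (S (x i))) + of_real k (t i) * f i (S' (x i))).
by rewrite flin mulrDr [in LHS]mulrCA.
Qed.

Lemma sre_mean S : sre (mean S) = \sum_i t i * sre (f i (S (x i))).
Proof. by rewrite sre_sum; apply: eq_bigr => i _; rewrite sreMl. Qed.

Lemma sim_mean S : sim (mean S) = \sum_i t i * sim (f i (S (x i))).
Proof.
rewrite [LHS]raddf_sum; apply: eq_bigr => i _; exact: simMl.
Qed.

Lemma mean_le S : operators S -> sre `|mean S| <= numerical_radius S.
Proof.
move=> SL; rewrite -[leRHS]mul1r -t_sum mulr_suml -(ler_of_real k) sreK //.
rewrite rmorph_sum /=; apply: le_trans (ler_norm_sum _ _ _) _.
apply: ler_sum => i _; rewrite normrM rmorphM /=.
rewrite -[`|of_real k (t i)|]sreK // sre_norm_of_real ger0_norm //.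
rewrite ler_wpM2l -?(rmorph0 (@of_real R k)) ?ler_of_real //.
by rewrite -[leLHS]sreK // ler_of_real le_numerical_radius.
Qed.

(** Weak duality: a mean that vanishes on the subspace takes the same value at [T] and at every
    [T - S]. *)
Lemma mean_le_dist : (forall S, V S -> mean S = 0) ->
  sre `|mean T| <= dist_w T V.
Proof.
move=> mV; apply: le_dist_w => S VS.
have -> : mean T = mean (T - S).
  have -> : T - S = -1 *: S + T by rewrite scaleN1r addrC.
  by rewrite mean_linear (mV S VS) scaler0 add0r.
by apply: mean_le; exact: operatorsB.
Qed.

End Distance.

(** * Choice of the weights and attainment of the maximum *)

Theorem theorem3p5 (R : realType) (k : scalar_kind)
    (X : completeNormedModType (scalars R k))
    (Xfin : finite_dimensional X)
    (wnorm : numerical_radius_is_norm X)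
    (n : nat) (V : set (X -> X))
    (VL : V `<=` @operators R k X) (Vdim : subspace_of_dim n V)
    (T : X -> X) (TL : operators T) (TV : ~ V T) :
  exists (h : nat) (t : 'I_h -> R),
    [/\ (h <= match k with
              | RealScalars => n + 1
              | ComplexScalars => 2 * n + 1
              end)%N,
        forall i, 0 < t i,
        \sum_(i < h) t i = 1
      & is_maximum
          [set v : scalars R k |
            exists (f : 'I_h -> X -> (scalars R k)^o) (x : 'I_h -> X),
              admissible T V t f x /\
              v = \sum_(i < h) of_real k (t i) * f i (T (x i))]
          (of_real k (dist_w T V))].
Proof.
have [b [_ VE]] := Vdim; rewrite {}VE in VL TV *.
have [m [s [mE sV _ _]]] := real_family b.
set d := dist_w T (lin_span b).
(* Coordinate 0 carries the objective and the remaining [m] coordinates the constraints. *)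
pose A (i : 'I_m.+1) := if unlift ord0 i is Some j then s j else T.
have A0 : A ord0 = T by rewrite /A unlift_none.
have AS j : A (lift ord0 j) = s j by rewrite /A liftK.
have Vs (c : 'I_m -> R) : lin_span b (\sum_j of_real k (c j) *: s j).
  by apply/sV; exists c.
have Vsj j : lin_span b (s j).
  apply/sV; exists (fun i => (i == j)%:R); rewrite (bigD1 j) //= eqxx rmorph1.
  rewrite scale1r big1 ?addr0 // => i /negPf ->.
  by rewrite rmorph0 scale0r.
have Alin i : linear (A i).
  case: (unliftP ord0 i) => [j|] ->; last by rewrite A0; case: TL.
  by rewrite AS; case: (VL _ (Vsj j)).
have T0 : T <> 0 by move=> T0; apply: TV; rewrite T0; exact: lin_span0.
have pairs := exists_unimodular_pair wnorm TL T0.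
pose p : 'rV[R]_m.+1 := d *: delta_mx 0 ord0.
have p_hull : convex_hull (extreme_values A) p.
  apply: support_extreme_pairs => // c r cr.
  have -> : (p *m c) 0 0 = c ord0 0 * d.
    by rewrite -scalemxAl -rowE !mxE mulrC.
  pose S := \sum_j of_real k (c (lift ord0 j) 0) *: s j.
  apply: (le_trans (dist_w_scale wnorm VL TL (c ord0 0) (Vs _ : lin_span b S))).
  apply: numerical_radius_le => // f x fB xB fx.
  have [flin _] := (dual_ballP f).1 fB.
  apply: le_trans (cr f x fB xB fx); rewrite mxE big_ord_recl /= mxE A0.
  change (sre (f (of_real k (c ord0 0) *: T x + S x)) <=
    sre (f (T x)) * c ord0 0 +
    \sum_(i < m) values A f x 0 (lift ord0 i) * c (lift ord0 i) 0).
  rewrite flin sreD sreMl mulrC lerD2l /S fct_sumE (linear_map_sum flin).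
  rewrite sre_sum.
  apply: ler_sum => j _; rewrite mxE AS.
  change (sre (f (of_real k (c (lift ord0 j) 0) *: s j x)) <=
    sre (f (s j x)) * c (lift ord0 j) 0).
  by rewrite (linear_mapZ flin) sreMl mulrC.
have [h0] := hull_convex_comb p_hull.
(* Multiplication by [G] drops coordinate 0, so [caratheodory] keeps the constraint coordinates at
   zero while coordinate 0 can only grow. *)
pose G : 'M[R]_(m.+1, m) := \matrix_(i, j) (i == lift ord0 j)%:R.
have GE (z : 'rV[R]_m.+1) j : (z *m G) 0 j = z 0 (lift ord0 j).
  rewrite mxE (bigD1 (lift ord0 j)) //= !mxE eqxx mulr1 big1 ?addr0 // => i.
  by rewrite mxE => /negPf ->; rewrite mulr0.
have aE (z : 'rV[R]_m.+1) : (z *m delta_mx ord0 0 : 'M[R]_1) 0 0 = z 0 ord0.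
  by rewrite -colE mxE.
move=> /(caratheodory G (delta_mx ord0 0))[h1 [p' [h1m p'comb p'G]]].
rewrite !aE => dp'.
have [h [t [z [hh1 t0 t1 zE p'E]]]] := convex_comb_pos p'comb.
have pairE i : exists fx : (X -> (scalars R k)^o) * X,
    extreme_pair fx.1 fx.2 /\ z i = values A fx.1 fx.2.
  by have [f [x [fx zi]]] := zE i; exists (f, x).
have [fx fxE] := choice pairE.
pose f i := (fx i).1; pose x i := (fx i).2.
have coordE j : \sum_i t i * sre (f i (A j (x i))) = p' 0 j.
  rewrite p'E summxE; apply: eq_bigr => i _.
  by rewrite mxE (fxE i).2 mxE.
have fB i : dual_ball (f i) by have [[[]]] := fxE i.
have xB i : unit_ball (x i) by have [[_ []]] := fxE i.
have fxi i : `|f i (x i)| = 1 by have [[]] := fxE i.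
have t0' i : 0 <= t i by exact: ltW.
have mlin := mean_linear t x fB.
have mean_s j : sre (mean t f x (s j)) = 0.
  rewrite sre_mean -AS coordE -GE p'G GE !mxE.
  by rewrite mulr0.
have sre_mean0 S : lin_span b S -> sre (mean t f x S) = 0.
  move=> /sV[c ->]; rewrite (linear_map_sum mlin) sre_sum big1 // => j _.
  by rewrite (linear_mapZ mlin) [LHS]sreMl mean_s mulr0.
(* The constraints control real parts only; imaginary parts vanish because the span is also stable
   under the imaginary unit. *)
have mean0 S : lin_span b S -> mean t f x S = 0.
  move=> VS; apply: scalar_eq; first by rewrite sre_mean0 // raddf0.
  rewrite raddf0 simE -[_ * _](linear_mapZ mlin) sre_mean0 ?oppr0 //.
  exact: lin_spanZ.
(* With [dT] this closes the chain d <= Re(mean T) <= |mean T| <= d, which gives both the value and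
   the vanishing imaginary part. *)
have meanT := mean_le_dist VL TL t0' t1 fB xB fxi mean0.
have dT : d <= sre (mean t f x T).
  by rewrite sre_mean -A0 coordE (le_trans _ dp') // !mxE eqxx mulr1.
have simT : sim (mean t f x T) = 0 by apply: sim_eq0; exact: le_trans dT.
exists h, t; split=> //.
- rewrite (leq_trans hh1) // (leq_trans h1m) // mE /real_dim.
  by case: (k); rewrite addn1.
split.
  exists f, x; split.
    by split=> // [i|]; [have [[]] := fxE i | rewrite -sim_mean].
  apply: scalar_eq; last by rewrite sim_of_real simT.
  rewrite sre_of_real; apply/eqP; rewrite eq_le dT /=.
  exact: le_trans (ler_sre_norm _) meanT.
(* For any other admissible family with the same weights, the condition on imaginary parts makes the
   mean real, hence comparable with [d] in the order of the scalars. *)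
move=> _ [g [y [[gy gy1 gim gV] ->]]]; rewrite -/(mean t g y T).
have gB i : dual_ball (g i) by have [[]] := gy i.
have yB i : unit_ball (y i) by have [_ []] := gy i.
have gT := mean_le_dist VL TL t0' t1 gB yB gy1 gV.
have -> : mean t g y T = of_real k (sre (mean t g y T)).
  by apply: scalar_eq; rewrite ?sre_of_real // sim_of_real sim_mean.
by rewrite ler_of_real (le_trans (ler_sre_norm _)).
Qed.
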